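(* Let $n\ge1$, $p\in(1,\infty)$, and let $\{e_i\}_{i=1}^n$ be the standard basis of $\mathbb{R}^n$. (a) If $s\in(1,2]$, then there is a constant $c>0$ such that for every $u\in W^{s,p}(\mathbb{R}^n)$, every $i\in\{1,\dots,n\}$ and every $h>0$, $$\left\|\frac{u(\cdot+e_ih)-u}{h}-\frac{\partial u}{\partial x_i}\right\|_{L^p(\mathbb{R}^n)}\le c\,[u]_{W^{s,p}(\mathbb{R}^n)}\,h^{s-1}.$$ (b) If $s\in(2,4]$, then there is a constant $c>0$ such that for every $u\in W^{s,p}(\mathbb{R}^n)$, every $i\in\{1,\dots,n\}$ and every $h>0$, $$\left\|\frac{u(\cdot+e_ih)+u(\cdot-e_ih)-2u}{h^2}-\frac{\partial^2u}{\partial x_i^2}\right\|_{L^p(\mathbb{R}^n)}\le c\,[u]_{W^{s,p}(\mathbb{R}^n)}\,h^{s-2}.$$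
   Context: For $\sigma\in(0,1)$ and $p\in[1,\infty)$ the normalised Gagliardo seminorm is $$[v]_{W^{\sigma,p}(\mathbb{R}^n)}=\left(\sigma(1-\sigma)\int_{\mathbb{R}^n}\int_{\mathbb{R}^n}\frac{|v(x)-v(y)|^p}{|x-y|^{n+\sigma p}}\,dx\,dy\right)^{1/p},$$ and $[v]_{W^{1,p}(\mathbb{R}^n)}=\|\nabla v\|_{L^p(\mathbb{R}^n)}$. For $s=k+\sigma$ with $k\ge1$ an integer and $\sigma\in(0,1]$, $[u]_{W^{s,p}(\mathbb{R}^n)}=\max_{|\alpha|=k}[D^\alpha u]_{W^{\sigma,p}(\mathbb{R}^n)}$ (multi-index notation, weak derivatives) and $W^{s,p}(\mathbb{R}^n)=\{u\in W^{k,p}(\mathbb{R}^n):[u]_{W^{s,p}(\mathbb{R}^n)}<+\infty\}$, where $W^{k,p}(\mathbb{R}^n)$ is the usual integer-order Sobolev space. *)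

(* Defs.v *)
From HB Require Import structures.
From mathcomp Require Import all_boot all_order all_algebra.
From mathcomp Require Import all_classical all_reals all_analysis.

Set Implicit Arguments.
Unset Strict Implicit.
Unset Printing Implicit Defensive.
Import Order.TTheory GRing.Theory Num.Theory.
Import numFieldNormedType.Exports.
Local Open Scope classical_set_scope.
Local Open Scope ring_scope.

(* R^n is 'rV[R]_n with the product sigma-algebra (for R : realType this is
   the Borel sigma-algebra of the norm topology). *)
Definition measure_rV_display : measure_display -> measure_display.
Proof. exact. Qed.

Section measurable_rV.
Context {d} {T : sigmaRingType d}.
Variable n : nat.

Let coors : 'I_n -> 'rV[T]_n -> T := fun i x => x ord0 i.

Let rV_set0 : g_sigma_preimage coors set0.
Proof. exact: sigma_algebra0. Qed.

Let rV_setC A : g_sigma_preimage coors A -> g_sigma_preimage coors (~` A).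
Proof. exact: sigma_algebraC. Qed.

Let rV_bigcup (F : _^nat) : (forall i, g_sigma_preimage coors (F i)) ->
  g_sigma_preimage coors (\bigcup_i (F i)).
Proof. exact: sigma_algebra_bigcup. Qed.

HB.instance Definition _ := @isMeasurable.Build (measure_rV_display d)
  'rV[T]_n (g_sigma_preimage coors) rV_set0 rV_setC rV_bigcup.

End measurable_rV.

Section lebesgue_rV.
Context {R : realType}.

Definition rV_cons n (x : R * 'rV[R]_n) : 'rV[R]_n.+1 :=
  row_mx (const_mx x.1) x.2 : 'rV_(1 + n).

Definition rV_uncons n (x : 'rV[R]_n.+1) : R * 'rV[R]_n :=
  (x ord0 ord0, rsubmx (x : 'rV_(1 + n))).

Lemma rV_cons0 n (x : R * 'rV[R]_n) : rV_cons x ord0 ord0 = x.1.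
Proof.
transitivity (row_mx (const_mx x.1 : 'rV_1) x.2 ord0 (lshift n ord0)).
  by congr (row_mx _ _ _ _); exact: val_inj.
by rewrite row_mxEl mxE.
Qed.

Lemma rV_consS n (x : R * 'rV[R]_n) j :
  rV_cons x ord0 (lift ord0 j) = x.2 ord0 j.
Proof.
transitivity (row_mx (const_mx x.1 : 'rV_1) x.2 ord0 (rshift 1 j)).
  by congr (row_mx _ _ _ _); exact: val_inj.
by rewrite row_mxEr.
Qed.

Lemma rV_consK n : cancel (@rV_cons n) (@rV_uncons n).
Proof.
by move=> [a v]; rewrite /rV_uncons rV_cons0 /rV_cons row_mxKr.
Qed.

Lemma measurable_coord n (i : 'I_n) :
  measurable_fun [set: 'rV[R]_n] (fun x : 'rV[R]_n => x ord0 i).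
Proof.
move=> _ Y mY; rewrite setTI; apply: sub_sigma_algebra => /=.
rewrite -bigcup_seq/=; exists i => /=; first by rewrite mem_index_enum.
by exists Y => //; rewrite setTI.
Qed.

Lemma measurable_fun_rV d (T : measurableType d) n (f : T -> 'rV[R]_n) :
  (forall i, measurable_fun [set: T] (fun x => f x ord0 i)) ->
  measurable_fun [set: T] f.
Proof.
move=> mf _ Y mY; rewrite setTI.
have : g_sigma_preimage (fun i x => f x ord0 i) `<=` measurable.
  apply: smallest_sub; first exact: sigma_algebra_measurable.
  by rewrite -bigcup_seq => A [i /= _ [B mB <-]]; exact: mf.
apply.
have := @g_sigma_preimage_comp _ R n 'rV[R]_n
  (fun i (x : 'rV[R]_n) => x ord0 i) T f.
by move=> /= ->; exists Y => //; rewrite setTI.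
Qed.

Lemma measurable_rV_cons n : measurable_fun setT (@rV_cons n).
Proof.
apply: measurable_fun_rV => i; case: (unliftP ord0 i) => [j|] ->.
  under eq_fun do rewrite rV_consS.
  exact: (measurableT_comp (measurable_coord j)).
by under eq_fun do rewrite rV_cons0; exact: measurable_fst.
Qed.

Lemma measurable_rV_uncons n : measurable_fun setT (@rV_uncons n).
Proof.
apply: measurable_fun_pair; first exact: measurable_coord.
apply: measurable_fun_rV => i.
under eq_fun do rewrite mxE; exact: measurable_coord.
Qed.

Section rV_cons_measure.
Variables (n : nat) (m : {sigma_finite_measure set 'rV[R]_n -> \bar R}).

Definition rV_cons_measure : set 'rV[R]_n.+1 -> \bar R :=
  pushforward (lebesgue_measure \x m)%E (@rV_cons n).

Let mf := @measurable_rV_cons n.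

Let rV_cons_measure0 : rV_cons_measure set0 = 0%E.
Proof. exact: measure0. Qed.

Let rV_cons_measure_ge0 A : (0 <= rV_cons_measure A)%E.
Proof. exact: measure_ge0. Qed.

Let rV_cons_measure_additive : semi_sigma_additive rV_cons_measure.
Proof. exact: measure_semi_sigma_additive. Qed.

HB.instance Definition _ := isMeasure.Build _ _ _ rV_cons_measure
  rV_cons_measure0 rV_cons_measure_ge0 rV_cons_measure_additive.

Let rV_cons_measure_sigma_finite : sigma_finite setT rV_cons_measure.
Proof.
have /sigma_finiteP[F [FT ndF Foo]] := sigma_finiteT (@lebesgue_measure R).
have /sigma_finiteP[G [GT ndG Goo]] := sigma_finiteT m.
exists (fun k => @rV_uncons n @^-1` (F k `*` G k)).
  apply/esym; rewrite -subTset => x _.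
  have [k _ Fk] : (\bigcup_k F k) (x ord0 ord0) by rewrite -FT.
  have [l _ Gl] : (\bigcup_k G k) (rV_uncons x).2 by rewrite -GT.
  exists (maxn k l) => //; split.
    by move: Fk; exact/subsetPset/ndF/leq_maxl.
  by move: Gl; exact/subsetPset/ndG/leq_maxr.
move=> k; have [mF Fk] := Foo k; have [mG Gk] := Goo k; split.
  rewrite -[X in measurable X]setTI; apply: measurable_rV_uncons => //.
  exact: measurableX.
rewrite /rV_cons_measure /pushforward -comp_preimage.
rewrite (_ : _ \o _ = id) ?preimage_id; last first.
  by apply/funext => x /=; rewrite rV_consK.
by rewrite product_measure1E// lte_mul_pinfty// ge0_fin_numE.
Qed.

HB.instance Definition _ := Measure_isSigmaFinite.Build _ _ _ rV_cons_measure
  rV_cons_measure_sigma_finite.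

End rV_cons_measure.

Fixpoint lebesgue_rV n : set 'rV[R]_n -> \bar R :=
  match n with
  | 0%N => \d_(0 : 'rV[R]_0)
  | m.+1 => pushforward (lebesgue_measure \x @lebesgue_rV m)%E (@rV_cons m)
  end.

Lemma lebesgue_rV_measure n :
  exists m : {sigma_finite_measure set 'rV[R]_n -> \bar R}, @lebesgue_rV n = m.
Proof.
elim: n => [|n [m mE]]; first by exists (\d_(0 : 'rV[R]_0)).
by exists (rV_cons_measure m); rewrite /= mE.
Qed.

Section instances.
Variable n : nat.

Let lebesgue_rV0 : @lebesgue_rV n set0 = 0%E.
Proof. by have [m ->] := lebesgue_rV_measure n; exact: measure0. Qed.

Let lebesgue_rV_ge0 A : (0 <= @lebesgue_rV n A)%E.
Proof. by have [m ->] := lebesgue_rV_measure n; exact: measure_ge0. Qed.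

Let lebesgue_rV_additive : semi_sigma_additive (@lebesgue_rV n).
Proof.
by have [m ->] := lebesgue_rV_measure n; exact: measure_semi_sigma_additive.
Qed.

HB.instance Definition _ := isMeasure.Build _ _ _ (@lebesgue_rV n)
  lebesgue_rV0 lebesgue_rV_ge0 lebesgue_rV_additive.

Let lebesgue_rV_sigma_finite : sigma_finite setT (@lebesgue_rV n).
Proof. by have [m ->] := lebesgue_rV_measure n; exact: sigma_finiteT. Qed.

HB.instance Definition _ := Measure_isSigmaFinite.Build _ _ _ (@lebesgue_rV n)
  lebesgue_rV_sigma_finite.

End instances.

End lebesgue_rV.
Arguments lebesgue_rV {R} n.

Section weak_derivatives.
Context {R : realType} {n : nat}.
Implicit Types (a : 'I_n -> nat) (f u v phi : 'rV[R]_n -> R).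

(* the matrix norm `|x| of the library is the sup norm *)
Definition enorm (x : 'rV[R]_n) : R := Num.sqrt (\sum_i x ord0 i ^+ 2).

Definition mdegree a : nat := (\sum_i a i)%N.

Definition pderiv (i : 'I_n) f : 'rV[R]_n -> R :=
  fun x => 'D_(delta_mx ord0 i) f x.

Definition mderiv a f : 'rV[R]_n -> R :=
  foldr (fun i g => iter (a i) (pderiv i) g) f (enum 'I_n).

Definition smooth f := forall l : seq 'I_n,
  continuous (foldr pderiv f l) /\
  forall i x, derivable (foldr pderiv f l) x (delta_mx ord0 i).

Definition test_function phi :=
  smooth phi /\ compact (closure [set x | phi x != 0]).

Definition loc_integrable f := measurable_fun setT f /\
  forall K, compact K -> (\int[lebesgue_rV n]_(x in K) `|f x|%:E < +oo)%E.

Definition is_weak_deriv a u v :=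
  [/\ loc_integrable u, loc_integrable v &
    forall phi, test_function phi ->
      \int[lebesgue_rV n]_x (u x * mderiv a phi x) =
      (-1) ^+ mdegree a * \int[lebesgue_rV n]_x (v x * phi x)].

(* a representative of D^a u, which is unique up to a null set;
   0 if u has no weak derivative of multi-index a *)
Definition weak_deriv a u : 'rV[R]_n -> R :=
  xget (cst 0) [set v | is_weak_deriv a u v].

(* the multi-index of d^m / dx_i^m *)
Definition mindex1 (i : 'I_n) (m : nat) : 'I_n -> nat :=
  fun j => if j == i then m else 0%N.

Definition weak_grad v (x : 'rV[R]_n) : 'rV[R]_n :=
  \row_i weak_deriv (mindex1 i 1) v x.

Definition weakly_differentiable v :=
  forall i, exists w, is_weak_deriv (mindex1 i 1) v w.

End weak_derivatives.

Section sobolev.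
Context {R : realType} {n : nat}.
Implicit Types (p s sigma : R) (k : nat) (u v : 'rV[R]_n -> R).
Local Open Scope ereal_scope.

(* On the diagonal x = y the integrand is 0 since 0 `^ p = 0 for p != 0. *)
Definition gagliardo_seminorm sigma p v : \bar R :=
  ((sigma * (1 - sigma))%:E *
    \int[lebesgue_rV n]_y \int[lebesgue_rV n]_x
      (`|v x - v y| `^ p / enorm (x - y) `^ (n%:R + sigma * p))%:E) `^ p^-1.

Definition gradient_seminorm p v : \bar R :=
  if `[< weakly_differentiable v >]
  then Lnorm (lebesgue_rV n) p%:E (fun x => (enorm (weak_grad v x))%:E)
  else +oo.

Definition frac_seminorm sigma p v : \bar R :=
  if sigma == 1%R then gradient_seminorm p v else gagliardo_seminorm sigma p v.

Definition sobolev_int k p u := u \in Lfun (lebesgue_rV n) p%:E /\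
  forall a : 'I_n -> nat, (mdegree a <= k)%N ->
    exists2 v, v \in Lfun (lebesgue_rV n) p%:E & is_weak_deriv a u v.

(* s = sobolev_order s + sobolev_frac s with sobolev_frac s in ]0, 1] *)
Definition sobolev_order s : nat := `|Num.ceil s|%N.-1.
Definition sobolev_frac s : R := (s - (sobolev_order s)%:R)%R.

(* the entries of a multi-index of degree k are at most k *)
Definition sobolev_seminorm s p u : \bar R :=
  \big[maxe/0]_(a : {ffun 'I_n -> 'I_(sobolev_order s).+1} |
                 mdegree (fun i => a i : nat) == sobolev_order s)
    frac_seminorm (sobolev_frac s) p (weak_deriv (fun i => a i : nat) u).

Definition sobolev s p u :=
  sobolev_int (sobolev_order s) p u /\ sobolev_seminorm s p u < +oo.

End sobolev.

Lemma sobolev_orderE (R : realType) (k : nat) (sigma : R) :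
  0 < sigma <= 1 -> sobolev_order (k%:R + sigma) = k.
Proof.
move=> /andP[s0 s1]; rewrite /sobolev_order.
suff -> : Num.ceil (k%:R + sigma) = k.+1 by [].
apply/ceil_def; rewrite -addn1 PoszD addrK intrD.
by rewrite ltrDl s0 lerD2l.
Qed.

(* Main.v *)
From HB Require Import structures.
Require Import Defs.
From mathcomp Require Import all_boot all_order all_algebra.
From mathcomp Require Import all_classical all_reals all_analysis.
From mathcomp Require Import measurable_realfun ring lra.

(** Everything rests on one representation formula ([weak_deriv_increment]): if
    [v] is the weak derivative of [u] in the direction [e_i], then for every real
    [h] and almost every [x]
      [u (x + h e_i) - u x = h * (average over t in [0, 1] of v (x + t h e_i))].
    Hence the error of the first difference quotient is the average over [t] of
    the increments [v (x + t h e_i) - v x].  By Jensen's inequality and Tonelli's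
    theorem the [L^p] norm of an average is at most the largest [L^p] norm of the
    averaged functions ([pint_average_le]), so it remains to bound the [L^p] norm
    of an increment of length at most [h] by [h ^ sigma] times the seminorm of
    order [sigma].

    For [sigma = 1] this is again the representation formula.  For [sigma < 1] it
    is the embedding of [W^(sigma, p)] into the Nikolskii space
    ([increment_gagliardo_le]): an increment along [y] is compared with the
    increments along [w] and [w - y], and averaging over all [w] in a cube of side
    comparable to [|y|] produces the Gagliardo double integral.

    The central second difference is treated by iterating the formula.  Written as
    an average of [v (x + t h e_i) - v (x - t h e_i) - 2 t h w x], where [w] is the
    second derivative, and then as an average of central second differences of [w],
    it is bounded by [h ^ 2] times the largest of the latter
    ([second_difference_le]).  For [s <= 3] these are sums of two increments of [w];
    for [s > 3] one more application of the formula turns them into symmetric first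
    differences of the third derivative, which gains a further factor [h].  The
    symmetry of the difference is what makes the odd order term cancel and allows
    orders up to 4.

    The formula itself is proved by duality.  Both sides are tested against a
    product [phi] of one-dimensional bumps; its average along the segment is again
    a product of test functions, whose derivative in the direction [e_i] is a
    difference of two translates of [phi], so the definition of the weak derivative
    applies to it.  Products of bumps suffice to conclude
    ([du_bois_reymond]), because they converge to indicators of boxes and boxes
    generate the sigma-algebra.

    No constant is tracked, so all estimates are stated for the [p]-th powers of
    the norms, as inequalities between extended real integrals. *)
Set Implicit Arguments.
Unset Strict Implicit.
Unset Printing Implicit Defensive.
Import Order.TTheory GRing.Theory Num.Theory.
Import numFieldNormedType.Exports.
Local Open Scope classical_set_scope.
Local Open Scope ring_scope.

(** * Translation invariance of Lebesgue measure *)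
Section translation.
Context {R : realType}.
Local Open Scope ereal_scope.

Lemma lebesgue_measure_shift (c : R) (A : set R) : measurable A ->
  pushforward (lebesgue_measure : set (measurableTypeR R) -> \bar R)
    (fun x : measurableTypeR R => (x + c)%R : measurableTypeR R) A = lebesgue_measure A.
Proof.
move=> mA; have mc : measurable_fun [set: measurableTypeR R]
    (fun x : measurableTypeR R => (x + c)%R : measurableTypeR R).
  exact: measurable_funD.
pose mc_mixin := isMeasurableFun.Build _ _ _ _ _ mc.
pose mc_pack : {mfun _ >-> _} := HB.pack
  (fun x : measurableTypeR R => (x + c)%R : measurableTypeR R) mc_mixin.
apply/esym.
apply: (@lebesgue_measure_unique _ (pushforward lebesgue_measure mc_pack)) => //=.
move=> _ [[a b]] _ <-.
rewrite /pushforward/=.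
rewrite (_ : _ @^-1` _ = `](a - c)%R, (b - c)%R]%classic); last first.
  by apply/seteqP; split=> x /=; rewrite !in_itv/= => /andP[? ?]; apply/andP; split; lra.
rewrite !lebesgue_measure_itv/= !lte_fin ltrD2r; case: ifPn => // _.
by rewrite -!EFinB; congr (_%:E); lra.
Qed.

Lemma ge0_integral_shift1 (f : R -> \bar R) (c : R) :
  measurable_fun setT f -> (forall x, 0 <= f x) ->
  \int[lebesgue_measure]_x f (x + c)%R = \int[lebesgue_measure]_x f x.
Proof.
move=> mf f0.
have mc : measurable_fun [set: measurableTypeR R]
    (fun x : measurableTypeR R => (x + c)%R : measurableTypeR R).
  exact: measurable_funD.
rewrite -[LHS](@ge0_integral_pushforward _ _ _ _ _ _ mc lebesgue_measure setT f)//.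
apply: eq_measure_integral => A mA _ /=; exact: lebesgue_measure_shift.
Qed.

Lemma ge0_integral_rVS n (f : 'rV[R]_n.+1 -> \bar R) :
  measurable_fun setT f -> (forall x, 0 <= f x) ->
  \int[lebesgue_rV n.+1]_x f x =
  \int[lebesgue_measure]_a \int[lebesgue_rV n]_v f (rV_cons (a, v)).
Proof.
move=> mf f0.
have mc := @measurable_rV_cons R n.
rewrite (eq_measure_integral (pushforward (lebesgue_measure \x lebesgue_rV n)
  (@rV_cons R n)))//.
rewrite ge0_integral_pushforward//= preimage_setT.
rewrite fubini_tonelli1//=.
exact: measurableT_comp.
Qed.

Lemma rV_cons_add n (a b : R) (v w : 'rV[R]_n) :
  (rV_cons (a, v) + rV_cons (b, w) = rV_cons (a + b, v + w))%R.
Proof.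
apply/rowP => i; rewrite mxE; case: (unliftP ord0 i) => [j|] ->.
  by rewrite !rV_consS mxE.
by rewrite !rV_cons0.
Qed.

Lemma rV_unconsK n : cancel (@rV_uncons R n) (@rV_cons R n).
Proof.
move=> x; apply/rowP => i; case: (unliftP ord0 i) => [j|] ->.
  rewrite rV_consS/= mxE; congr (x _ _); exact: val_inj.
by rewrite rV_cons0.
Qed.

Lemma measurable_rV_add n (y : 'rV[R]_n) :
  measurable_fun [set: 'rV[R]_n] (fun x : 'rV[R]_n => x + y)%R.
Proof.
apply: measurable_fun_rV => i.
under eq_fun do rewrite mxE.
by apply: measurable_funD => //; exact: measurable_coord.
Qed.

(** By induction on the dimension: one coordinate is translated at a time, the
    iterated integrals being given by Tonelli's theorem. *)
Lemma ge0_integral_shift n (f : 'rV[R]_n -> \bar R) (y : 'rV[R]_n) :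
  measurable_fun setT f -> (forall x, 0 <= f x) ->
  \int[lebesgue_rV n]_x f (x + y)%R = \int[lebesgue_rV n]_x f x.
Proof.
elim: n f y => [|n IH] f y mf f0.
  by congr integral; apply/funext => x; congr f; apply/rowP => -[].
have mfy : measurable_fun setT (fun x : 'rV[R]_n.+1 => f (x + y)%R).
  by apply: (measurableT_comp mf); exact: measurable_rV_add.
rewrite (ge0_integral_rVS mf f0).
etransitivity; first exact: (ge0_integral_rVS mfy (fun x => f0 _)).
rewrite -(rV_unconsK y); case: (rV_uncons y) => b w.
transitivity (\int[lebesgue_measure]_a \int[lebesgue_rV n]_v f (rV_cons (a + b, v)%R)).
  apply: eq_integral => a _.
  rewrite -[RHS](IH _ w)//.
    by apply: eq_integral => v _; rewrite rV_cons_add.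
  apply: (measurableT_comp mf).
  apply: measurable_fun_rV => i; case: (unliftP ord0 i) => [j|] ->.
    by under eq_fun do rewrite rV_consS; exact: measurable_coord.
  by under eq_fun do rewrite rV_cons0; exact: measurable_cst.
have := @ge0_integral_shift1 (fun a => \int[lebesgue_rV n]_v f (rV_cons (a, v))) b.
apply.
  apply: (@measurable_fun_fubini_tonelli_F _ _ (measurableTypeR R) _ _
    (lebesgue_rV n) (fun z => f (rV_cons z))) => //.
  apply: measurableT_comp => //; exact: measurable_rV_cons.
by move=> a; apply: integral_ge0.
Qed.

Lemma integral_shift n (f : 'rV[R]_n -> \bar R) (y : 'rV[R]_n) :
  (lebesgue_rV n).-integrable setT f ->
  \int[lebesgue_rV n]_x f (x + y)%R = \int[lebesgue_rV n]_x f x.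
Proof.
move=> fi; have mf := measurable_int _ fi.
rewrite [LHS]integralE [RHS]integralE; congr (_ - _).
  transitivity (\int[lebesgue_rV n]_x f^\+ (x + y)%R);
    first by congr integral; exact: (funepos_comp f).
  by apply: ge0_integral_shift => //; exact: measurable_funepos.
transitivity (\int[lebesgue_rV n]_x f^\- (x + y)%R);
  first by congr integral; exact: (funeneg_comp f).
by apply: ge0_integral_shift => //; exact: measurable_funeneg.
Qed.

Lemma integrable_shift n (f : 'rV[R]_n -> \bar R) (y : 'rV[R]_n) :
  (lebesgue_rV n).-integrable setT f ->
  (lebesgue_rV n).-integrable setT (fun x => f (x + y)%R).
Proof.
move=> /integrableP[mf fi]; apply/integrableP; split.
  by apply: measurableT_comp => //; exact: measurable_rV_add.
rewrite (ge0_integral_shift (f := fun x => `|f x|))//.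
exact: measurableT_comp.
Qed.

Definition cube n (r : R) : set 'rV[R]_n := [set x | forall i, `|x ord0 i| < r]%R.

Lemma measurable_cube n r : measurable (@cube n r).
Proof.
rewrite (_ : cube _ = \bigcap_(i in [set: 'I_n])
  (fun x : 'rV[R]_n => x ord0 i) @^-1` `](-r)%R, r[%classic); last first.
  apply/seteqP; split=> x /=.
    by move=> xr i _ /=; rewrite in_itv/= -ltr_norml.
  by move=> xr i; move: (xr i I); rewrite /= in_itv/= -ltr_norml.
apply: fin_bigcap_measurable => //.
move=> i _; rewrite -[X in measurable X]setTI; apply: measurable_coord => //.
Qed.

Lemma lebesgue_rV_cube n r : (0 < r)%R -> lebesgue_rV n (cube r) = ((2 * r) ^+ n)%:E.
Proof.
move=> r0; elim: n => [|n IH].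
  by rewrite /= diracE expr0 mem_set//; case.
rewrite /= /pushforward (_ : _ @^-1` _ = `](-r)%R, r[ `*` @cube n r); last first.
  apply/seteqP; split => -[a v] /=.
    move=> h; split.
      by have := h ord0; rewrite rV_cons0 in_itv/= -ltr_norml.
    by move=> j; have := h (lift ord0 j); rewrite rV_consS.
  rewrite in_itv/= -ltr_norml => -[ar vr] i; case: (unliftP ord0 i) => [j|] ->.
    by rewrite rV_consS; exact: vr.
  by rewrite rV_cons0.
rewrite product_measure1E//; last exact: measurable_cube.
transitivity (lebesgue_measure `](-r)%R, r[%classic * lebesgue_rV n (cube r)) => //.
rewrite lebesgue_measure_itv/= lte_fin IH ifT; last lra.
by rewrite -EFinB -EFinM exprS; congr ((_ * _)%:E); lra.
Qed.
End translation.

(** * Smooth functions of one variable *)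
Section smooth1.
Context {R : realType}.
Implicit Types (f g : R -> R) (k : nat).

(** The derivative is quantified existentially, so that closure properties are
    proved by exhibiting the derivative and induction on the order. *)
Fixpoint derivable_upto k g : Prop :=
  if k is k'.+1 then
    exists2 g', forall x : R, is_derive x 1 g (g' x) & derivable_upto k' g'
  else True.

Definition smooth1 g := forall k, derivable_upto k g.

Lemma derivable_uptoW k g : derivable_upto k.+1 g -> derivable_upto k g.
Proof.
elim: k g => [//|k IH] g [g' gg' dg']; exists g' => //; exact: IH.
Qed.

Lemma is_derive_derive1 g g' : (forall x : R, is_derive x 1 g (g' x)) -> derive1 g = g'.
Proof. by move=> gg'; apply/funext => x; rewrite derive1E; apply: derive_val. Qed.

Lemma smooth1_is_derive g (x : R) : smooth1 g -> is_derive x 1 g (derive1 g x).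
Proof.
by move=> /(_ 1%N)[g' gg' _]; rewrite (is_derive_derive1 gg').
Qed.

Lemma smooth1_derive1 g : smooth1 g -> smooth1 (derive1 g).
Proof.
by move=> sg k; have [g' gg' dg'] := sg k.+1; rewrite (is_derive_derive1 gg').
Qed.

Lemma smooth1_primitive g g' : (forall x : R, is_derive x 1 g (g' x)) ->
  smooth1 g' -> smooth1 g.
Proof. by move=> gg' sg' [//|k]; exists g'. Qed.

Lemma smooth1_continuous g : smooth1 g -> continuous g.
Proof.
move=> sg x; apply: differentiable_continuous; apply/derivable1_diffP.
by have [] := smooth1_is_derive x sg.
Qed.

Lemma derivable_uptoD k f g :
  derivable_upto k f -> derivable_upto k g -> derivable_upto k (f \+ g).
Proof.
elim: k f g => [//|k IH] f g [f' ff' df'] [g' gg' dg'].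
by exists (f' \+ g') => [x|]; [exact: is_deriveD|exact: IH].
Qed.

Lemma derivable_uptoM k f g :
  derivable_upto k f -> derivable_upto k g -> derivable_upto k (f \* g).
Proof.
elim: k f g => [//|k IH] f g df dg.
have dfk := derivable_uptoW df; have dgk := derivable_uptoW dg.
case: df dg => [f' ff' df'] [g' gg' dg'].
exists ((f \* g') \+ (g \* f')) => [x|].
  exact: is_deriveM.
by apply: derivable_uptoD; apply: IH.
Qed.

Lemma derivable_upto_cst k (c : R) : derivable_upto k (cst c).
Proof.
elim: k c => [//|k IH] c; exists (cst 0) => [x|]; [exact: is_derive_cst|exact: IH].
Qed.

Lemma is_derive_affine g (g' c d x : R) : is_derive (c * x + d) 1 g g' ->
  is_derive x 1 (fun x => g (c * x + d)) (g' * c).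
Proof.
move=> gg'.
have ? : is_derive x 1 (fun x => c * x + d) c.
  by apply: is_derive_eq; rewrite /= addr0 scaler1.
exact: is_derive1_comp.
Qed.

Lemma derivable_upto_affine k g (c d : R) :
  derivable_upto k g -> derivable_upto k (fun x => g (c * x + d)).
Proof.
elim: k g => [//|k IH] g [g' gg' dg'].
exists ((fun x => g' (c * x + d)) \* cst c) => [x|].
  exact: is_derive_affine.
by apply: derivable_uptoM; [exact: IH|exact: derivable_upto_cst].
Qed.

Lemma smooth1M f g : smooth1 f -> smooth1 g -> smooth1 (f \* g).
Proof. by move=> sf sg k; apply: derivable_uptoM. Qed.

Lemma smooth1B f g : smooth1 f -> smooth1 g -> smooth1 (f \- g).
Proof.
move=> sf sg k.
rewrite (_ : f \- g = f \+ (cst (-1) \* g)); last first.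
  by apply/funext => x; rewrite /= mulN1r.
by apply: derivable_uptoD => //; apply: derivable_uptoM => //; exact: derivable_upto_cst.
Qed.

Lemma smooth1_affine g (c d : R) : smooth1 g -> smooth1 (fun x => g (c * x + d)).
Proof. by move=> sg k; exact: derivable_upto_affine. Qed.

(** The functions [P (1 / x) exp (- 1 / x)] on the positive half-line.  A
    polynomial factor is allowed because the family is then closed under
    differentiation, which gives smoothness of all its members at once. *)
Definition flat (P : {poly R}) (x : R) :=
  if 0 < x then P.[x^-1] * expR (- x^-1) else 0.

Lemma exprn_expR_bound k (y : R) : 0 <= y -> y ^+ k * expR (- y) <= k`!%:R.
Proof.
move=> y0; rewrite expRN ler_pdivrMr ?expR_gt0//.
case: k => [|k].
  by rewrite expr0 fact0 mul1r; apply: le_trans (expR_ge1Dx y); rewrite lerDl.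
rewrite mulrC -ler_pdivrMr ?ltr0n ?fact_gt0//.
by apply: le_trans; last exact: expR_ge1Dxn; rewrite lerDr.
Qed.

(** The power [y ^+ k] serves the induction: multiplying the polynomial by the
    variable raises [k] by one. *)
Lemma poly_expR_bound (P : {poly R}) k :
  exists C, forall y, 0 <= y -> `|P.[y]| * y ^+ k * expR (- y) <= C.
Proof.
elim/poly_ind: P k => [|P c IH] k.
  by exists 0 => y _; rewrite horner0 normr0 !mul0r.
have [C HC] := IH k.+1; exists (C + `|c| * k`!%:R) => y y0.
rewrite hornerMXaddC.
apply: (@le_trans _ _ (`|P.[y]| * y ^+ k.+1 * expR (- y) + `|c| * (y ^+ k * expR (- y)))).
  rewrite mulrA -mulrDl ler_wpM2r ?expR_ge0// exprS mulrA -mulrDl.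
  rewrite ler_wpM2r ?exprn_ge0//.
  by apply: (le_trans (ler_normD _ _)); rewrite normrM (ger0_norm y0).
by apply: lerD; [exact: HC|rewrite ler_wpM2l// exprn_expR_bound].
Qed.

(** Away from 0 this is the chain rule.  At 0 the difference quotient is
    [y P(y) exp (- y)] with [y = 1 / h], which is at most a constant times
    [1 / y = h] since [y ^ 2 P(y) exp (- y)] is bounded. *)
Lemma is_derive_flat (P : {poly R}) (x : R) :
  is_derive x 1 (flat P) (flat ('X^2 * (P - P^`())) x).
Proof.
have [x0|x0|->] := ltgtP x 0.
- have -> : flat ('X^2 * (P - P^`())) x = 0 by rewrite /flat ltNge (ltW x0).
  apply: (near_eq_is_derive (f := cst 0)).
  near=> y; rewrite /flat ltNge ltW//=.
  near: y; exact: lt_nbhsl.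
- apply: (near_eq_is_derive (f := (horner P \o @GRing.inv R) \* (expR \o -%R \o @GRing.inv R))).
    near=> y; rewrite /flat ifT//=; near: y; exact: lt_nbhsr.
  have xn0 : x != 0 by rewrite gt_eqF.
  have dV : is_derive x 1 (@GRing.inv R) (- x ^- 2).
    have := @is_deriveV _ id x 1 1 xn0 (is_derive_id x 1).
    by rewrite scaler1.
  have dP : is_derive x 1 (horner P \o @GRing.inv R) (P^`().[x^-1] * (- x ^- 2)).
    exact: is_derive1_comp.
  have dN : is_derive x 1 (-%R \o @GRing.inv R) ((-1) * (- x ^- 2)).
    exact: is_derive1_comp.
  have dE : is_derive x 1 (expR \o (-%R \o @GRing.inv R))
    (expR (- x^-1) * ((-1) * (- x ^- 2))).
    exact: is_derive1_comp.
  apply: is_derive_eq.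
  rewrite /flat x0 /= !hornerE/= -!exprVn /GRing.scale/=; ring.
have -> : flat ('X^2 * (P - P^`())) 0 = 0 by rewrite /flat ltxx.
have [C HC] := poly_expR_bound P 2.
have C0 : 0 <= C by have := HC 0 (lexx 0); rewrite expr2 mul0r mulr0 mul0r.
suff H : h^-1 *: ((flat P \o shift 0) h%:A - flat P 0) @[h --> 0^'] --> (0 : R).
  by apply: DeriveDef; [apply/cvg_ex; exists 0|exact/cvg_lim].
have C1 : 0 < C + 1 by lra.
apply/cvgrPdist_le => e e0; near=> h.
rewrite sub0r normrN /= /flat ltxx subr0 addr0 /GRing.scale /= mulr1.
case: ifPn => [h0|]; last by rewrite mulr0 normr0 ltW.
have hV : 0 <= h^-1 by rewrite invr_ge0 ltW.
have := HC _ hV => HCh.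
rewrite !normrM (ger0_norm hV) (ger0_norm (expR_ge0 _)).
apply: (@le_trans _ _ (C * h)).
  rewrite -ler_pdivrMr//; apply: le_trans HCh.
  rewrite le_eqVlt; apply/orP; left; apply/eqP.
  by field; rewrite gt_eqF.
apply: (@le_trans _ _ ((C + 1) * h)); first by rewrite ler_wpM2r ?(ltW h0)// lerDl.
rewrite -ler_pdivlMl//; apply/ltW/(le_lt_trans (ler_norm h)); near: h.
by apply: dnbhs0_lt; rewrite mulr_gt0// invr_gt0.
Unshelve. all: by end_near. Qed.

Lemma smooth1_flat P : smooth1 (flat P).
Proof.
move=> k; elim: k P => [//|k IH] P.
by exists (flat ('X^2 * (P - P^`()))) => // x; exact: is_derive_flat.
Qed.

(** A bump supported in [[a, b]]; it tends to the indicator of the open interval as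
    the scale [c] goes to infinity. *)
Definition bumpf (c a b : R) (x : R) := flat 1 (c * (x - a)) * flat 1 (c * (b - x)).

Lemma flat1_ge0 x : 0 <= flat 1 x.
Proof. by rewrite /flat; case: ifP => // _; rewrite hornerC mul1r expR_ge0. Qed.

Lemma flat1_le1 x : flat 1 x <= 1.
Proof.
rewrite /flat; case: ifP => // x0; rewrite hornerC mul1r expR_le1 oppr_le0.
by rewrite invr_ge0 ltW.
Qed.

Lemma bump_ge0 c a b x : 0 <= bumpf c a b x.
Proof. by rewrite mulr_ge0// flat1_ge0. Qed.

Lemma bump_le1 c a b x : bumpf c a b x <= 1.
Proof. by rewrite mulr_ile1// ?flat1_ge0// flat1_le1. Qed.

Lemma bump0 c a b x : 0 < c -> ~~ (a < x < b) -> bumpf c a b x = 0.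
Proof.
move=> c0; rewrite negb_and -!leNgt => /orP[xa|bx]; rewrite /bumpf /flat.
  by rewrite ifF ?mul0r//; apply/negbTE; rewrite -leNgt pmulr_rle0// subr_le0.
rewrite [X in _ * X]ifF ?mulr0//; apply/negbTE.
by rewrite -leNgt pmulr_rle0// subr_le0.
Qed.

Lemma smooth1_bump c a b : smooth1 (bumpf c a b).
Proof.
apply: (@smooth1M (fun x => flat 1 (c * (x - a))) (fun x => flat 1 (c * (b - x)))).
  have := @smooth1_affine _ c (- (c * a)) (@smooth1_flat 1).
  by under eq_fun do rewrite -mulrBr.
have := @smooth1_affine _ (- c) (c * b) (@smooth1_flat 1).
by under eq_fun do rewrite mulNr addrC -mulrBr.
Qed.

Lemma flat1_cvg (x : R) : 0 < x -> (fun k : nat => flat 1 (k.+1%:R * x)) @ \oo --> (1 : R).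
Proof.
move=> x0.
have -> : (fun k : nat => flat 1 (k.+1%:R * x))
  = (expR \o (fun k : nat => - (k.+1%:R^-1 * x^-1))).
  apply/funext => k; rewrite /flat mulr_gt0 ?ltr0n//= hornerC mul1r invfM//.
rewrite -[X in _ --> X]expR0.
apply: (@cvg_comp _ _ _ (fun k : nat => - (k.+1%:R^-1 * x^-1)) expR);
  last exact: continuous_expR.
have : (fun k : nat => - (k.+1%:R^-1 * x^-1)) @ \oo --> - (0 * x^-1).
  by apply: cvgN; apply: cvgMl; exact: cvg_harmonic.
by rewrite mul0r oppr0.
Qed.

Lemma bump_cvg a b x :
  (fun k : nat => bumpf k.+1%:R a b x) @ \oo --> (\1_(`]a, b[%classic) x : R).
Proof.
rewrite indicE; have [|] := boolP (a < x < b) => [/andP[ax xb]|abx].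
  rewrite mem_set/= ?in_itv/= ?ax// -[1%:R]mulr1.
  by apply: cvgM; apply: flat1_cvg; rewrite subr_gt0.
rewrite memNset/= ?in_itv/=; last exact/negP.
by under eq_fun do rewrite bump0//; exact: cvg_cst.
Qed.

Lemma bump_continuous c a b : continuous (bumpf c a b).
Proof. exact/smooth1_continuous/smooth1_bump. Qed.

Definition test1 g := smooth1 g /\ exists M : R, forall x, M < `|x| -> g x = 0.

Lemma test1_bump c a b : 0 < c -> test1 (bumpf c a b).
Proof.
move=> c0; split; first exact: smooth1_bump.
exists (`|a| + `|b|) => x; move=> H; apply: bump0 => //.
apply/negP => /andP[ax xb]; move: H; rewrite ltNge => /negP; apply.
by rewrite ler_norml; apply/andP; split;
  have := ler_norm a; have := ler_norm b;
  have := ler_norm (- a); have := ler_norm (- b); rewrite !normrN;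
  have := normr_ge0 a; have := normr_ge0 b; lra.
Qed.

Lemma test1_derive1 g : test1 g -> test1 (derive1 g).
Proof.
move=> [sg [M gM]]; split; first exact: smooth1_derive1.
exists M => x Mx.
have [_ <-] : is_derive x 1 g 0; last by rewrite derive1E.
apply: (near_eq_is_derive (f := cst 0)).
near=> y; rewrite gM//.
near: y; exact: (@norm_continuous _ R^o x _ (lt_nbhsr Mx)).
Unshelve. all: by end_near. Qed.

End smooth1.

(** * The average of a bump along a segment *)
Section difference_primitive.
Context {R : realType}.
Local Notation mu := (@lebesgue_measure R).
Local Notation unif := (uniform_prob (@ltr01 R)).
Variables (g : R -> R) (g0 : forall x, 0 <= g x) (tg : test1 g) (h : R).

(** The primitive of [g s - g (s - h)] that is again compactly supported. *)
Definition avg_primitive (s : R) : R :=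
  h * fine (\int[unif]_t (g (s - t * h))%:E)%E.

Lemma test1_integrable : mu.-integrable setT (EFin \o g).
Proof.
have [sg [M gM]] := tg.
have -> : EFin \o g = (EFin \o g) \_ `[- M, M]%classic.
  apply/funext => x; rewrite patchE; case: ifPn => //.
  rewrite notin_setE/= in_itv/= -ler_norml => /negP; rewrite -ltNge => Mx.
  by rewrite /= gM.
rewrite -integrable_mkcond//.
apply: continuous_compact_integrable; first exact: segment_compact.
by apply: continuous_subspaceT; exact: smooth1_continuous.
Qed.

Lemma test1_primitive : exists H : R -> R, forall x : R, is_derive x 1 H (g x).
Proof.
exists (fun x : R => \int[mu]_(t in `]-oo, x]) g t) => x.
have cg := smooth1_continuous tg.1.
have [] := @continuous_FTC1 R g -oo%O x (x + 1) _ _ _ (cg x).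
- by rewrite ltrDl.
- by apply: integrableS test1_integrable.
- by rewrite ltNyr.
by move=> dF; rewrite derive1E => dF'; exact: (DeriveDef dF dF').
Qed.

(** The integrand is, up to the factor [- h], the derivative in [t] of
    [H (s - t * h)]. *)
Lemma avg_primitiveE (H : R -> R) s : (forall x : R, is_derive x 1 H (g x)) ->
  avg_primitive s = H s - H (s - h).
Proof.
move=> dH; rewrite /avg_primitive.
have [->|h0] := eqVneq h 0; first by rewrite mul0r subr0 subrr.
have cg := smooth1_continuous tg.1.
have cgs : continuous (fun t : R => g (s - t * h)).
  have := smooth1_continuous (smooth1_affine (- h) s tg.1).
  by under eq_fun do rewrite mulNr addrC mulrC.
rewrite integral_uniform//; last 2 first.
- by apply/measurable_EFinP; apply: continuous_measurable_fun.
- by move=> x; rewrite lee_fin.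
have dF (t : R) : is_derive t 1 (fun t => - h^-1 * H (- h * t + s)) (g (s - t * h)).
  have dHt := is_derive_affine (dH (- h * t + s)).
  have -> : (fun t => - h^-1 * H (- h * t + s)) =
    (- h^-1) \*: (fun t : R => H (- h * t + s)) by [].
  apply: is_derive_eq.
  rewrite /GRing.scale/= (_ : - h * t + s = s - t * h); last by ring.
  by field.
rewrite subr0 invr1 mul1e.
rewrite (@continuous_FTC2 _ _ (fun t => - h^-1 * H (- h * t + s)))//=.
- rewrite mulr1 mulr0 add0r (addrC (-h)); by field.
- exact: continuous_subspaceT.
- have cF : continuous (fun t => - h^-1 * H (- h * t + s)).
    move=> t; apply: differentiable_continuous; apply/derivable1_diffP.
    by have [] := dF t.
  split.
  + by move=> x _; have [] := dF x.
  + exact/cvg_at_right_filter/cF.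
  + exact/cvg_at_left_filter/cF.
- by move=> x _; rewrite derive1E; have [_] := dF x.
Qed.

Lemma is_derive_avg_primitive (s : R) :
  is_derive s 1 avg_primitive (g s - g (s - h)).
Proof.
have [H dH] := test1_primitive.
rewrite (_ : avg_primitive = fun s => H s - H (s - h)); last first.
  by apply/funext => x; exact: avg_primitiveE.
have := is_derive_affine (dH (1 * s - h)); rewrite mulr1 mul1r.
under eq_fun do rewrite mul1r.
exact: is_deriveB.
Qed.

Lemma test1_avg_primitive : test1 avg_primitive.
Proof.
have [sg [M gM]] := tg; split.
  apply: smooth1_primitive is_derive_avg_primitive _.
  have := smooth1_affine 1 (- h) sg; under eq_fun do rewrite mul1r.
  exact: smooth1B.
exists (M + `|h|) => s Ms; rewrite /avg_primitive.
rewrite integral_uniform//; last 2 first.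
- apply/measurable_EFinP; apply: continuous_measurable_fun.
  have := smooth1_continuous (smooth1_affine (- h) s tg.1).
  by under eq_fun do rewrite mulNr addrC mulrC.
- by move=> x; rewrite lee_fin.
rewrite (eq_integral (cst 0%E)) ?integral0 ?mule0 ?mulr0//.
move=> t; rewrite inE/= in_itv/= => /andP[t0 t1]; rewrite gM//.
have : `|s| <= `|s - t * h| + `|t * h|.
  by apply: le_trans (ler_normD _ _); rewrite subrK.
have : `|t * h| <= `|h| by rewrite normrM (ger0_norm t0) ler_piMl.
by move: Ms; lra.
Qed.
End difference_primitive.

(** * Tensor products of test functions *)
Section tensor.
Context {R : realType} {n : nat}.
Implicit Types (g : 'I_n -> R -> R).

Definition tensor g (x : 'rV[R]_n) : R := \prod_i g i (x ord0 i).

Definition subst_factor g i f : 'I_n -> R -> R := fun j => if j == i then f else g j.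

Lemma tensor_subst_factor g i f x :
  tensor (subst_factor g i f) x = f (x ord0 i) * \prod_(j | j != i) g j (x ord0 j).
Proof.
rewrite /tensor (bigD1 i)//= /subst_factor eqxx; congr (_ * _).
by apply: eq_bigr => j ji; rewrite (negbTE ji).
Qed.

Lemma tensorD1 g i x :
  tensor g x = g i (x ord0 i) * \prod_(j | j != i) g j (x ord0 j).
Proof. by rewrite /tensor (bigD1 i). Qed.

Lemma subst_factor_id g i : subst_factor g i (g i) = g.
Proof. by apply/funext => j; rewrite /subst_factor; case: eqP => [->|]. Qed.

Lemma is_derive_tensor g i (x : 'rV[R]_n) : smooth1 (g i) ->
  is_derive x (delta_mx ord0 i) (tensor g) (tensor (subst_factor g i (derive1 (g i))) x).
Proof.
move=> sg; rewrite tensor_subst_factor -{1}(subst_factor_id g i).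
set c := \prod_(_ | _) _.
have [] := smooth1_is_derive (x ord0 i) sg.
rewrite /derivable /derive.
set q := (fun h : R => _) => qcv qE.
(* the difference quotient is that of the i-th factor, times a constant *)
suff E : (fun h : R => h^-1 *: ((tensor (subst_factor g i (g i)) \o shift x)
  (h *: delta_mx ord0 i) -
     tensor (subst_factor g i (g i)) x)) = fun h => q h * c.
  have H : (fun h => q h * c) @ 0^' --> derive1 (g i) (x ord0 i) * c.
    by apply: cvgMl; rewrite -qE.
  apply: DeriveDef; first by rewrite /derivable E; apply/cvg_ex; eexists; exact: H.
  by rewrite /derive E; apply/cvg_lim => //; exact: H.
apply/funext => h; rewrite /= !tensor_subst_factor /q /= /c !mxE !eqxx /=.
rewrite (eq_bigr (fun j => g j (x ord0 j))); last first.
  by move=> j ji; rewrite !mxE eqxx (negbTE ji) mulr0 add0r.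
by rewrite -mulrBl /GRing.scale/= mulrA.
Qed.

Lemma pderiv_tensor g i : smooth1 (g i) ->
  pderiv i (tensor g) = tensor (subst_factor g i (derive1 (g i))).
Proof.
by move=> sg; apply/funext => x; rewrite /pderiv; have [_] := is_derive_tensor x sg.
Qed.

Lemma tensor_continuous g : (forall i, continuous (g i)) -> continuous (tensor g).
Proof.
move=> cg.
apply: (@continuous_big _ _ _ _ xpredT (@mul_continuous R) 'rV[R]_n
  (index_enum 'I_n) (fun i x => g i (x ord0 i))).
move=> i _ x; apply: (@continuous_comp _ _ _ (fun x : 'rV[R]_n => x ord0 i) (g i)).
  exact: coord_continuous.
exact: cg.
Qed.

(** Products are stable under all partial derivatives: differentiating replaces
    one factor by its derivative. *)
Lemma smooth_tensor g : (forall i, smooth1 (g i)) -> smooth (tensor g).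
Proof.
move=> sg l.
have [g' sg' ->] : exists2 g', (forall i, smooth1 (g' i)) & foldr pderiv (tensor g) l = tensor g'.
  elim: l => [|i l [g' sg' IH]]; first by exists g.
  exists (subst_factor g' i (derive1 (g' i))); last by rewrite /= IH pderiv_tensor.
  by move=> j; rewrite /subst_factor; case: eqP => // _; exact: smooth1_derive1.
split; first by apply: tensor_continuous => i; exact: smooth1_continuous.
by move=> i x; have [] := is_derive_tensor x (sg' i).
Qed.

Lemma test_function_tensor g : (forall i, test1 (g i)) -> test_function (tensor g).
Proof.
move=> tg; split; first by apply: smooth_tensor => i; exact: (tg i).1.
have /choice[M gM] : forall i, exists M : R, forall x, M < `|x| -> g i x = 0.
  by move=> i; have [_] := tg i.
pose K := [set v : 'rV[R]_n | forall i, `[- M i, M i]%classic (v ord0 i)].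
have cK : compact K.
  apply: (@rV_compact _ _ (fun i => `[- M i, M i]%classic)) => i.
  exact: segment_compact.
apply: (subclosed_compact _ cK); first exact: closed_closure.
have clK : closed K by apply: compact_closed => //; exact: norm_hausdorff.
rewrite [X in _ `<=` X](closure_id K).1//.
apply: closure_subset => x /= gx i; rewrite /= in_itv/= -ler_norml leNgt.
apply/negP => /gM gi; move: gx; rewrite /tensor (bigD1 i)//= gi mul0r eqxx//.
Qed.

Lemma mderiv_mindex1 (i : 'I_n) m (f : 'rV[R]_n -> R) :
  mderiv (mindex1 i m) f = iter m (pderiv i) f.
Proof.
rewrite /mderiv.
have H0 (s : seq 'I_n) : i \notin s ->
    foldr (fun j (g : 'rV[R]_n -> R) => iter (mindex1 i m j) (pderiv j) g) f s = f.
  elim: s => //= j s IH; rewrite inE negb_or => /andP[ij /IH ->].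
  by rewrite /mindex1 eq_sym (negbTE ij).
have : uniq (enum 'I_n) by exact: enum_uniq.
have : i \in enum 'I_n by rewrite mem_enum.
elim: (enum 'I_n) => //= j s IH; rewrite inE => /orP[/eqP <-|is'] /andP[js us].
  by rewrite H0// /mindex1 eqxx.
rewrite IH// {1}/mindex1 ifN//; apply: contraNneq js => ->//.
Qed.

Lemma mdegree_mindex1 (i : 'I_n) m : mdegree (mindex1 i m) = m.
Proof.
rewrite /mdegree (bigD1 i)//= /mindex1 eqxx big1 ?addn0// => j /negbTE -> //.
Qed.
End tensor.

(** * Boxes, and tensor products of bumps *)
Section boxes.
Context {R : realType} {n : nat}.
Local Notation mu := (@lebesgue_rV R n).

Definition openbox (a b : 'I_n -> R) : set 'rV[R]_n :=
  [set x | forall i, a i < x ord0 i < b i].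

Lemma measurable_openbox a b : measurable (openbox a b).
Proof.
rewrite (_ : openbox a b = \bigcap_(i in [set: 'I_n])
    (fun x : 'rV[R]_n => x ord0 i) @^-1` `]a i, b i[%classic); last first.
  by apply/seteqP; split=> x /= h i; [move=> _|]; move: (h i); rewrite /= in_itv//=; exact.
apply: fin_bigcap_measurable => // i _.
by rewrite -[X in measurable X]setTI; exact: measurable_coord.
Qed.

Lemma openboxI a b a' b' : openbox a b `&` openbox a' b' =
  openbox (fun i => Num.max (a i) (a' i)) (fun i => Num.min (b i) (b' i)).
Proof.
apply/seteqP; split=> x /=.
  move=> [h h'] i; move: (h i) (h' i) => /andP[? ?] /andP[? ?].
  by rewrite gt_max lt_min; apply/andP; split; apply/andP.
move=> h; split=> i; move: (h i); rewrite gt_max lt_min => /andP[/andP[? ?] /andP[? ?]];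
  exact/andP.
Qed.

Lemma cube_openbox r : cube r = openbox (fun=> - r) (fun=> r).
Proof. by apply/seteqP; split=> x /= h i; have := h i; rewrite ltr_norml. Qed.

Definition openboxes := [set A | exists a b, A = openbox a b].

Lemma bigcup_cube : \bigcup_k cube k%:R = [set: 'rV[R]_n].
Proof.
apply/seteqP; split=> // x _.
exists (Num.truncn (\sum_i `|x ord0 i|)).+1 => // i.
apply: le_lt_trans (truncnS_gt _).
by rewrite (bigD1 i)//= lerDl sumr_ge0.
Qed.

(** The identity from the sigma-algebra generated by boxes to the product
    sigma-algebra is measurable since its coordinates are: the preimage of a
    half-line is the union of boxes with one side fixed on the left. *)
Lemma measurable_rV_openboxes : @measurable _ 'rV[R]_n = <<s openboxes >>.
Proof.
apply/seteqP; split; last first.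
  apply: smallest_sub; first exact: sigma_algebra_measurable.
  by move=> _ [a [b ->]]; exact: measurable_openbox.
move=> A mA.
have : measurable_fun [set: g_sigma_algebraType openboxes]
    (fun x : g_sigma_algebraType openboxes => x : 'rV[R]_n).
  apply: measurable_fun_rV => i.
  apply: (measurability _ (RGenOInfty.measurableE R)) => _ [_ [a ->] <-].
  rewrite setTI (_ : _ @^-1` _ =
    \bigcup_k openbox (fun j => if j == i then a else - k%:R) (fun=> k%:R)).
    apply: bigcupT_measurable => k; apply: sub_sigma_algebra.
    by exists (fun j => if j == i then a else - k%:R), (fun=> k%:R).
  apply/seteqP; split=> x /=.
    rewrite in_itv/= andbT => ax.
    have : (\bigcup_k cube k%:R) x by rewrite bigcup_cube.
    move=> [k _ kx]; exists k => // j.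
    have := kx j; rewrite ltr_norml => /andP[xk ->]; rewrite andbT.
    by case: eqP => [->|].
  by move=> [k _ /(_ i)]; rewrite eqxx in_itv/= andbT => /andP[].
by move=> /(_ measurableT _ mA); rewrite setTI.
Qed.

Lemma measurable_tensor (g : 'I_n -> R -> R) :
  (forall i, measurable_fun setT (g i)) -> measurable_fun setT (tensor g).
Proof.
move=> mg; rewrite /tensor.
apply: (@measurable_prod _ _ _ _ _ (index_enum 'I_n) (fun i (x : 'rV[R]_n) => g i (x ord0 i))).
move=> i _.
apply: (measurableT_comp (f := g i)) => //; exact: measurable_coord.
Qed.

(** Local integrability tested on cubes, a form that is evidently stable under
    translations and under averages of translates. *)
Definition cube_integrable (w : 'rV[R]_n -> R) :=
  measurable_fun setT w /\ forall r, mu.-integrable (cube r) (EFin \o w).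

Lemma loc_integrable_cube (w : 'rV[R]_n -> R) :
  loc_integrable w -> cube_integrable w.
Proof.
move=> [mw wK]; split=> // r.
pose K := [set v : 'rV[R]_n | forall i, `[- r, r]%classic (v ord0 i)].
have cK : compact K.
  apply: (@rV_compact _ _ (fun i => `[- r, r]%classic)) => i.
  exact: segment_compact.
have mK : measurable K.
  rewrite (_ : K = \bigcap_(i in [set: 'I_n])
    (fun x : 'rV[R]_n => x ord0 i) @^-1` `[- r, r]%classic); last first.
    by apply/seteqP; split=> x /= h i; [move=> _|]; exact: h.
  apply: fin_bigcap_measurable => // i _.
  by rewrite -[X in measurable X]setTI; exact: measurable_coord.
have cubeK : cube r `<=` K.
  by move=> x rx i; rewrite /= in_itv/= -ler_norml ltW.
apply: (integrableS mK) => //; first exact: measurable_cube.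
apply/integrableP; split.
  by apply/measurable_EFinP; exact: measurable_funTS.
exact: wK.
Qed.

Lemma openbox_sub_cube a b : exists r, openbox a b `<=` cube r.
Proof.
pose r := \sum_i (`|a i| + `|b i|); exists r.
move=> x abx i; have /andP[ax xb] := abx i.
have : `|a i| + `|b i| <= r.
  by rewrite /r (bigD1 i)//= lerDl sumr_ge0// => j _; rewrite addr_ge0.
have := ler_norm (- a i); have := ler_norm (b i); rewrite normrN.
have := normr_ge0 (a i); have := normr_ge0 (b i).
by move=> *; rewrite ltr_norml; apply/andP; split; lra.
Qed.

Lemma integrable_openbox (w : 'rV[R]_n -> R) a b : cube_integrable w ->
  mu.-integrable (openbox a b) (EFin \o w).
Proof.
move=> [_ lw]; have [r abr] := openbox_sub_cube a b.
apply: (integrableS _ _ abr (lw r)).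
- exact: measurable_cube.
- exact: measurable_openbox.
Qed.

Lemma tensor_bump_cvg (a b : 'I_n -> R) (x : 'rV[R]_n) :
  (fun k : nat => tensor (fun i => bumpf k.+1%:R (a i) (b i)) x) @ \oo -->
  (\1_(openbox a b) x : R).
Proof.
have -> : \1_(openbox a b) x = \prod_i (\1_(`]a i, b i[%classic) (x ord0 i)) :> R.
  rewrite indicE; have [|] := boolP (x \in openbox a b).
    rewrite inE => abx; rewrite big1// => i _; rewrite indicE mem_set//=.
    by rewrite in_itv/= abx.
  rewrite notin_setE => /existsNP[i abx].
  by rewrite (bigD1 i)//= indicE memNset/= ?mul0r// in_itv.
apply: (@cvg_big _ _ _ _ xpredT (@mul_continuous R) nat \oo (index_enum 'I_n)
  (fun i (k : nat) => bumpf k.+1%:R (a i) (b i) (x ord0 i))) => i _.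
exact: bump_cvg.
Qed.

Lemma tensor_bump_ge0 c a b (x : 'rV[R]_n) : 0 <= tensor (fun i => bumpf c (a i) (b i)) x.
Proof. by apply: prodr_ge0 => i _; exact: bump_ge0. Qed.

Lemma tensor_bump_le1 c a b (x : 'rV[R]_n) : tensor (fun i => bumpf c (a i) (b i)) x <= 1.
Proof. by apply: prodr_ile1 => i _; rewrite bump_ge0 bump_le1. Qed.

Lemma tensor_bump0 c a b (x : 'rV[R]_n) : 0 < c -> ~ openbox a b x ->
  tensor (fun i => bumpf c (a i) (b i)) x = 0.
Proof.
move=> c0 /existsNP[i /negP abx].
by rewrite /tensor (bigD1 i)//= bump0 ?mul0r.
Qed.

Lemma integral_tensor_bump (w : 'rV[R]_n -> R) c a b : 0 < c ->
  (\int[mu]_x (w x * tensor (fun i => bumpf c (a i) (b i)) x)%:E =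
   \int[mu]_(x in openbox a b) (w x * tensor (fun i => bumpf c (a i) (b i)) x)%:E)%E.
Proof.
move=> c0; rewrite [RHS]integral_mkcond; apply: eq_integral => x _.
rewrite patchE; case: ifPn => //; rewrite notin_setE => abx.
by rewrite tensor_bump0// mulr0.
Qed.

Lemma measurable_tensor_bump c a b : measurable_fun [set: 'rV[R]_n]
  (tensor (fun i => bumpf c (a i) (b i))).
Proof.
by apply: measurable_tensor => i; apply: continuous_measurable_fun; exact: bump_continuous.
Qed.

Lemma integrable_tensor_bump (w : 'rV[R]_n -> R) c a b : 0 < c -> cube_integrable w ->
  mu.-integrable setT (EFin \o (fun x => w x * tensor (fun i => bumpf c (a i) (b i)) x)).
Proof.
move=> c0 lw.
rewrite (_ : EFin \o _ = (fun x => (w x * tensor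
  (fun i => bumpf c (a i) (b i)) x)%:E) \_ (openbox a b)).
  rewrite -integrable_mkcond; last exact: measurable_openbox.
  apply: (le_integrable _ _ _ (integrable_openbox a b lw)).
  - exact: measurable_openbox.
  - apply/measurable_EFinP/measurable_funTS; apply: measurable_funM; first exact: lw.1.
    exact: measurable_tensor_bump.
  - move=> x _ /=; rewrite lee_fin normrM ler_piMr// ger0_norm ?tensor_bump_le1//.
    exact: tensor_bump_ge0.
apply/funext => x; rewrite patchE /=; case: ifPn => //; rewrite notin_setE => abx.
by rewrite tensor_bump0// mulr0.
Qed.

End boxes.

(** * The lemma of du Bois-Reymond *)
Section density.
Context d (T : measurableType d) (R : realType).
Variables (mu : {measure set T -> \bar R}) (f : T -> \bar R).
Hypotheses (mf : measurable_fun setT f) (f0 : forall x, (0 <= f x)%E).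

Definition density (A : set T) : \bar R := (\int[mu]_(x in A) f x)%E.

Let density0 : density set0 = 0%E.
Proof. exact: integral_set0. Qed.

Let density_ge0 A : (0 <= density A)%E.
Proof. exact: integral_ge0. Qed.

Let density_sigma_additive : semi_sigma_additive density.
Proof.
move=> F mF tF mUF; rewrite /density ge0_integral_bigcup//.
  apply: is_cvg_ereal_nneg_natsum_cond => i _ _; exact: integral_ge0.
exact: measurable_funTS.
Qed.

HB.instance Definition _ := isMeasure.Build _ _ _ density
  density0 density_ge0 density_sigma_additive.

Definition density_measure : {measure set T -> \bar R} := density.

End density.

Section du_bois_reymond.
Context {R : realType} {n : nat}.
Local Notation mu := (@lebesgue_rV R n).
Variables (w : 'rV[R]_n -> R) (lw : cube_integrable w).
Hypothesis w0 : forall (k : nat) (a b : 'I_n -> R),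
  \int[mu]_x (w x * tensor (fun i => bumpf k.+1%:R (a i) (b i)) x) = 0.

(** Dominated convergence: the products of bumps converge to the indicator of the
    box. *)
Lemma integral_openbox0 a b : (\int[mu]_(x in openbox a b) (w x)%:E = 0)%E.
Proof.
have mab := measurable_openbox a b.
have iw := integrable_openbox a b lw.
pose f_ (k : nat) x := (w x * tensor (fun i => bumpf k.+1%:R (a i) (b i)) x)%:E.
have [] := @dominated_convergence _ _ _ mu _ mab f_ (EFin \o w) (abse \o EFin \o w).
- move=> k; apply/measurable_EFinP/measurable_funTS; apply: measurable_funM; first exact: lw.1.
  exact: measurable_tensor_bump.
- by apply/measurable_EFinP/measurable_funTS; exact: lw.1.
- apply: aeW => x abx; apply: cvg_EFin; first by apply: nearW.
  have := @tensor_bump_cvg _ _ a b x; rewrite indicE mem_set// => h.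
  rewrite -[X in _ --> X]mulr1; apply: cvgMr; exact: h.
- exact: integrable_abse.
- apply: aeW => x k abx; rewrite /f_ /= lee_fin normrM ler_piMr// ger0_norm ?tensor_bump_le1//.
  exact: tensor_bump_ge0.
move=> _ _; rewrite (_ : (fun k => _) = cst 0%E).
  by move=> /cvg_lim; rewrite lim_cst// => <-.
apply/funext => k /=; have := w0 k a b; rewrite /Rintegral integral_tensor_bump// => /eqP.
rewrite -eqe fineK ?EFin0; first by move=> /eqP.
apply: integrable_fin_num => //.
by apply: integrableS (integrable_tensor_bump a b _ lw).
Qed.

(** The measures with densities the positive and negative parts of [w] on the cube
    are finite and agree on boxes, which are stable under intersection and generate
    the measurable sets; so they are equal. *)
Lemma integral_sub_cube0 r (E : set 'rV[R]_n) : measurable E -> E `<=` cube r ->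
  (\int[mu]_(x in E) (w x)%:E = 0)%E.
Proof.
move=> mE Er; have mr := @measurable_cube R n r.
have mw : measurable_fun setT (EFin \o w) by apply/measurable_EFinP; exact: lw.1.
have iw := lw.2 r.
pose fp := ((EFin \o w)^\+ \_ (cube r))%E; pose fn := ((EFin \o w)^\- \_ (cube r))%E.
have mfp : measurable_fun setT fp.
  have m : measurable_fun (cube r) (EFin \o w)^\+%E.
    by apply: measurable_funepos; exact: measurable_funTS.
  exact: (measurable_restrictT _ mr).1 m.
have mfn : measurable_fun setT fn.
  have m : measurable_fun (cube r) (EFin \o w)^\-%E.
    by apply: measurable_funeneg; exact: measurable_funTS.
  exact: (measurable_restrictT _ mr).1 m.
have fp0 x : (0 <= fp x)%E by apply: erestrict_ge0 => y _; exact: funepos_ge0.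
have fn0 x : (0 <= fn x)%E by apply: erestrict_ge0 => y _; exact: funeneg_ge0.
pose mp := density_measure mu mfp fp0; pose mn := density_measure mu mfn fn0.
have E0 : mp E = mn E.
  apply: (measure_unique openboxes (fun k => cube k%:R)) => //.
  - exact: measurable_rV_openboxes.
  - move=> _ _ [a [b ->]] [a' [b' ->]]; rewrite openboxI.
    by eexists; eexists; reflexivity.
  - by move=> k; rewrite cube_openbox; eexists; eexists; reflexivity.
  - exact: bigcup_cube.
  - move=> _ [a [b ->]]; rewrite /mp /mn /= /density /= -!integral_mkcondr.
    rewrite cube_openbox openboxI.
    set a' := fun i => _; set b' := fun i => _.
    have h := integral_openbox0 a' b'; rewrite integralE in h.
    have iw' := integrable_openbox a' b' lw.
    have fnum : (\int[mu]_(x in openbox a' b') (EFin \o w)^\- x)%E \is a fin_num.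
      by apply: integrable_neg_fin_num => //; exact: measurable_openbox.
    by rewrite -[LHS](@subeK _ _ _ fnum) [X in (X + _)%E]h add0e.
  - move=> k; rewrite /mp /= /density /= -integral_mkcondr.
    apply: (@le_lt_trans _ _ (\int[mu]_(x in cube r) (EFin \o w)^\+ x)%E).
      apply: ge0_subset_integral => //.
      + by apply: measurableI => //; exact: measurable_cube.
      + by apply/measurable_funTS; exact: measurable_funepos.
    have := integrable_pos_fin_num mr iw.
    by rewrite ge0_fin_numE// integral_ge0.
rewrite integralE.
have Ep : (\int[mu]_(x in E) (EFin \o w)^\+ x = mp E)%E.
  by rewrite /mp /= /density /= -integral_mkcondr setIidl.
have En : (\int[mu]_(x in E) (EFin \o w)^\- x = mn E)%E.
  by rewrite /mn /= /density /= -integral_mkcondr setIidl.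
rewrite Ep En E0 subee// -En integrable_neg_fin_num//.
exact: integrableS iw.
Qed.

Lemma du_bois_reymond : {ae mu, forall x, w x = 0}.
Proof.
have H (k : nat) : {ae mu, forall x, cube k%:R x -> (w x)%:E = 0%E}.
  apply: (@integral_ae_eq _ _ _ mu _ _ (cst 0%E) (EFin \o w)) => //.
  - exact: measurable_cube.
  - exact: lw.2.
  - by move=> E Ek mE; rewrite integral0 (integral_sub_cube0 mE Ek).
have := @ae_foralln _ _ _ mu _ H; apply: filterS => x h.
have : (\bigcup_k cube k%:R) x by rewrite bigcup_cube.
by move=> [k _ kx]; have [] := h k kx.
Qed.

End du_bois_reymond.

(** * Averages along segments *)
Section uniform01.
Context {R : realType}.
Local Notation unif := (uniform_prob (@ltr01 R)).

Lemma integral_unif_le (B : R -> \bar R) C : measurable_fun setT B ->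
  (forall t, 0 <= B t)%E -> (forall t, (0 <= t <= 1)%R -> (B t <= C)%E) ->
  (\int[unif]_t B t <= C)%E.
Proof.
move=> mB B0 BC; rewrite integral_uniform// subr0 invr1 mul1e.
apply: (@le_trans _ _ (\int[lebesgue_measure]_(x in `[0%R, 1%R]) C)%E).
  apply: ge0_le_integral => //; first by apply: measurable_funTS.
rewrite integral_cst//= lebesgue_measure_itv/= lte_fin ltr01.
by rewrite oppr0 adde0 mule1.
Qed.
End uniform01.

Section cube_integrable.
Context {R : realType} {n : nat}.
Local Notation mu := (@lebesgue_rV R n).
Implicit Types (u v : 'rV[R]_n -> R) (y : 'rV[R]_n).

Lemma cube_sub r s : r <= s -> @cube R n r `<=` cube s.
Proof. by move=> rs x xr i; exact: lt_le_trans (xr i) rs. Qed.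

Lemma cube_shift y r t (x : 'rV[R]_n) : 0 <= t <= 1 -> cube r x ->
  cube (r + \sum_i `|y ord0 i|) (x + t *: y).
Proof.
move=> /andP[t0 t1] xr i; rewrite !mxE; apply: (le_lt_trans (ler_normD _ _)).
apply: ltr_leD; first exact: xr.
rewrite normrM (ger0_norm t0) (bigD1 i)//=.
apply: (@le_trans _ _ `|y ord0 i|); first by rewrite ler_piMl.
by rewrite lerDl sumr_ge0.
Qed.

Lemma cube_integrable_shift y u : cube_integrable u ->
  cube_integrable (fun x => u (x + y)).
Proof.
move=> [mu_ iu]; split.
  by apply: (measurableT_comp mu_); exact: measurable_rV_add.
move=> r; have mr := @measurable_cube R n r.
pose s := r + \sum_i `|y ord0 i|; have ms := @measurable_cube R n s.
rewrite integrable_mkcond//.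
have H : mu.-integrable setT ((EFin \o u) \_ (cube s)).
  by rewrite -integrable_mkcond//; exact: iu.
apply: (le_integrable measurableT _ _ (integrable_shift y H)).
- have m : measurable_fun (cube r) (EFin \o (fun x => u (x + y))).
    apply/measurable_EFinP/measurable_funTS.
    by apply: (measurableT_comp mu_); exact: measurable_rV_add.
  exact: (measurable_restrictT _ mr).1 m.
- move=> x _; rewrite !patchE; case: ifPn => [|_]; last by rewrite abse0 abse_ge0.
  rewrite inE => xr; rewrite mem_set//.
  by have := @cube_shift y r 1 x; rewrite scale1r lexx ler01; apply.
Qed.

Lemma cube_integrableB u v : cube_integrable u -> cube_integrable v ->
  cube_integrable (fun x => u x - v x).
Proof.
move=> [mu_ iu] [mv iv]; split; first exact: measurable_funB.
by move=> r; apply: (integrableB (measurable_cube r) (iu r) (iv r)).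
Qed.

Lemma cube_integrableZ c u : cube_integrable u -> cube_integrable (fun x => c * u x).
Proof.
move=> [mu_ iu]; split; first exact: measurable_funM.
by move=> r; apply: (integrableZl (measurable_cube r) c (iu r)).
Qed.

End cube_integrable.

Section line_average.
Context {R : realType} {n : nat}.
Local Notation mu := (@lebesgue_rV R n).
Local Notation unif := (uniform_prob (@ltr01 R)).
Variables (v : 'rV[R]_n -> R) (y : 'rV[R]_n).

(** The average of [v] over the segment from [x] to [x + y]; it is meaningful at
    almost every [x] by [ae_integrable_line]. *)
Definition line_average (x : 'rV[R]_n) : R :=
  fine (\int[unif]_t (v (x + t *: y))%:E)%E.

Lemma measurable_line (c : R) : measurable_fun [set: 'rV[R]_n * measurableTypeR R]
  (fun z => z.1 + (c * z.2) *: y).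
Proof.
apply: measurable_fun_rV => i; under eq_fun do rewrite !mxE.
apply: measurable_funD.
  exact: (measurableT_comp (measurable_coord i) measurable_fst).
apply: measurable_funM => //; apply: measurable_funM => //; exact: measurable_snd.
Qed.

Hypothesis cv : cube_integrable v.

Lemma measurable_along_line : measurable_fun [set: 'rV[R]_n * measurableTypeR R]
  (fun z => v (z.1 + z.2 *: y)).
Proof.
apply: (measurableT_comp cv.1).
by have := measurable_line 1; under eq_fun do rewrite mul1r.
Qed.

(** For fixed [t] in [[0, 1]] the integral over [x] is bounded, after a
    translation, by the integral of the modulus of [v] over a larger cube. *)
Lemma integrable_line_cube (phi : 'rV[R]_n -> R) r :
  measurable_fun setT phi -> (forall x, `|phi x| <= 1) ->
  (forall x, ~ cube r x -> phi x = 0) ->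
  (mu \x unif)%E.-integrable setT
    (fun z : 'rV[R]_n * measurableTypeR R => (v (z.1 + z.2 *: y) * phi z.1)%:E).
Proof.
move=> mphi phi1 phi0.
have mF : measurable_fun [set: 'rV[R]_n * measurableTypeR R]
    (fun z => (v (z.1 + z.2 *: y) * phi z.1)%:E).
  apply/measurable_EFinP/measurable_funM; first exact: measurable_along_line.
  exact: (measurableT_comp mphi measurable_fst).
apply/(integrable21ltyP _ _ mF).
pose s := r + \sum_i `|y ord0 i|; have ms := @measurable_cube R n s.
pose C := (\int[mu]_(x in cube s) `|v x|%:E)%E.
have Coo : (C < +oo)%E by have /integrableP[_] := cv.2 s.
apply: le_lt_trans Coo; apply: integral_unif_le.
- apply: (@measurable_fun_fubini_tonelli_G _ _ _ _ _ mu
  (abse \o (fun z : 'rV[R]_n * measurableTypeR R => (v (z.1 + z.2 *: y) * phi z.1)%:E))) => //=.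
  exact: measurableT_comp.
- by move=> t; apply: integral_ge0.
- move=> t t01 /=.
  have mvs : measurable_fun setT (fun x : 'rV[R]_n => (`|v x| * \1_(cube s) x)%:E).
    apply/measurable_EFinP/measurable_funM; last exact: measurable_indic.
    by apply: measurableT_comp => //; exact: cv.1.
  apply: (@le_trans _ _ (\int[mu]_x ((`|v (x + t *: y)| * \1_(cube s) (x + t *: y))%:E))%E).
    apply: ge0_le_integral => //.
    + apply/measurable_EFinP/(measurableT_comp (@normr_measurable R setT)).
      apply: measurable_funM => //.
      by apply: (measurableT_comp cv.1); exact: measurable_rV_add.
    + by apply: (measurableT_comp mvs); exact: measurable_rV_add.
    + move=> x _ /=; rewrite lee_fin normrM ler_wpM2l// indicE.
      have [xr|xr] := pselect (cube r x).
        by rewrite mem_set//; exact: cube_shift.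
      by rewrite phi0// normr0.
  rewrite (ge0_integral_shift (f := fun x => (`|v x| * \1_(cube s) x)%:E))//.
  rewrite /C [leRHS]integral_mkcond; apply: ge0_le_integral => //.
  + have m : measurable_fun (cube s) (fun x => `|v x|%:E).
      apply/measurable_EFinP/measurable_funTS.
      by apply: measurableT_comp => //; exact: cv.1.
    exact: (measurable_restrictT _ ms).1 m.
  + move=> x _; rewrite patchE indicE; case: ifPn => _; rewrite ?mulr1//.
    by rewrite mulr0.
Qed.

Lemma ae_integrable_line :
  {ae mu, forall x, unif.-integrable setT (fun t : measurableTypeR R => (v (x + t *: y))%:E)}.
Proof.
have H (k : nat) : {ae mu, forall x, unif.-integrable setT
    (fun t : measurableTypeR R => (v (x + t *: y) * \1_(cube k%:R) x)%:E)}.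
  apply: (ae_integrable1 (integrable_line_cube (r := k%:R) _ _ _)) => //.
  - by apply: measurable_indic; exact: measurable_cube.
  - by move=> x; rewrite indicE; case: (_ \in _); rewrite ?normr1 ?normr0.
  - by move=> x kx; rewrite indicE memNset.
have := @ae_foralln _ _ _ mu _ H; apply: filterS => x h.
have : (\bigcup_k cube k%:R) x by rewrite bigcup_cube.
move=> [k _ kx]; have := h k; rewrite indicE mem_set//.
by under eq_fun do rewrite mulr1.
Qed.

Lemma measurable_line_average : measurable_fun setT line_average.
Proof.
apply: (measurableT_comp (f := fine)) => //.
pose F (z : 'rV[R]_n * measurableTypeR R) := (v (z.1 + z.2 *: y))%:E.
have mF : measurable_fun setT F.
  by apply/measurable_EFinP; exact: measurable_along_line.
rewrite (_ : (fun x => _) = (fun x => \int[unif]_t F^\+ (x, t)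
  - \int[unif]_t F^\- (x, t))%E); last first.
  apply/funext => x; rewrite integralE; congr (_ - _)%E; congr integral.
    exact: (funepos_comp F (pair x)).
  exact: (funeneg_comp F (pair x)).
apply: emeasurable_funB.
  apply: (@measurable_fun_fubini_tonelli_F _ _ _ _ _ unif F^\+%E).
    exact: measurable_funepos.
  by move=> x; exact: funepos_ge0.
apply: (@measurable_fun_fubini_tonelli_F _ _ _ _ _ unif F^\-%E).
  exact: measurable_funeneg.
by move=> x; exact: funeneg_ge0.
Qed.

Lemma integral_line_average (phi : 'rV[R]_n -> R) r :
  measurable_fun setT phi -> (forall x, `|phi x| <= 1) ->
  (forall x, ~ cube r x -> phi x = 0) ->
  ae_eq mu setT (fun x => \int[unif]_t (v (x + t *: y) * phi x)%:E)%E
    (fun x => (line_average x * phi x)%:E).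
Proof.
move=> mphi phi1 phi0.
have := ae_integrable_line; apply: filterS => x iv _.
have fin : (\int[unif]_t (v (x + t *: y))%:E)%E \is a fin_num.
  exact: integrable_fin_num.
rewrite EFinM /line_average fineK// -integralZr//.
Qed.

Lemma cube_integrable_line_average : cube_integrable line_average.
Proof.
split; first exact: measurable_line_average.
move=> r; have mr := @measurable_cube R n r.
rewrite integrable_mkcond//.
have mphi : measurable_fun setT (\1_(cube r) : 'rV[R]_n -> R) by exact: measurable_indic.
have phi1 (x : 'rV[R]_n) : `|\1_(cube r) x| <= 1 :> R.
  by rewrite indicE; case: (_ \in _); rewrite ?normr1 ?normr0.
have phi0 (x : 'rV[R]_n) : ~ cube r x -> \1_(cube r) x = 0 :> R.
  by move=> rx; rewrite indicE memNset.
have iF := integrable_fubini_F (integrable_line_cube mphi phi1 phi0).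
have aeF := integral_line_average mphi phi1 phi0.
have -> : (EFin \o line_average) \_ (cube r) = (fun x => (line_average x * \1_(cube r) x)%:E).
  apply/funext => x; rewrite patchE indicE; case: ifPn => _; rewrite ?mulr1//.
  by rewrite mulr0.
have mFr : measurable_fun setT (fun x => (line_average x * \1_(cube r) x)%:E).
  by apply/measurable_EFinP/measurable_funM => //; exact: measurable_line_average.
apply/integrableP; split => //.
have /integrableP[mF] := iF; congr (_ < _)%E.
apply: ae_eq_integral => //.
- exact: measurableT_comp.
- exact: measurableT_comp.
- by apply: filterS aeF => x h _; rewrite /fubini_F h.
Qed.

Lemma integrable_line_cube_dual (phi : 'rV[R]_n -> R) r :
  measurable_fun setT phi -> (forall x, `|phi x| <= 1) ->
  (forall x, ~ cube r x -> phi x = 0) ->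
  (mu \x unif)%E.-integrable setT
    (fun z : 'rV[R]_n * measurableTypeR R => (v z.1 * phi (z.1 - z.2 *: y))%:E).
Proof.
move=> mphi phi1 phi0.
have iF := integrable_line_cube mphi phi1 phi0.
have mF := measurable_int _ iF.
pose G (z : 'rV[R]_n * measurableTypeR R) := (v z.1 * phi (z.1 - z.2 *: y))%:E.
have mG : measurable_fun setT G.
  apply/measurable_EFinP/measurable_funM.
    exact: (measurableT_comp cv.1 measurable_fst).
  apply: (measurableT_comp mphi).
  have := measurable_line (-1); under eq_fun do rewrite mulN1r scaleNr.
  exact.
have Eabs t : (\int[mu]_x `|G (x, t)| = \int[mu]_x `|(v (x + t *: y) * phi x)%:E|)%E.
  rewrite -(ge0_integral_shift (t *: y) (f := fun x => `|G (x, t)|%E))//; last first.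
    by apply: measurableT_comp => //; exact: (measurable_fun_pair1 _ mG).
  by apply: eq_integral => x _; rewrite /G/= addrK.
apply/(integrable21ltyP _ _ mG).
under eq_integral do rewrite Eabs.
exact: (integrable21ltyP _ _ mF).1 iF.
Qed.

(** Averaging forwards along the segment is adjoint to averaging backwards:
    exchange the integrals and translate by [t *: y]. *)
Lemma line_average_duality (phi : 'rV[R]_n -> R) r :
  measurable_fun setT phi -> (forall x, `|phi x| <= 1) ->
  (forall x, ~ cube r x -> phi x = 0) ->
  (\int[mu]_x (line_average x * phi x)%:E =
   \int[mu]_x \int[unif]_t (v x * phi (x - t *: y))%:E)%E.
Proof.
move=> mphi phi1 phi0.
have iF := integrable_line_cube mphi phi1 phi0.
have mF := measurable_int _ iF.
have aeF := integral_line_average mphi phi1 phi0.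
transitivity (\int[mu]_x \int[unif]_t (v (x + t *: y) * phi x)%:E)%E.
  apply: ae_eq_integral => //.
  - apply/measurable_EFinP/measurable_funM => //; exact: measurable_line_average.
  - exact: (measurable_fubini_F iF).
  - exact: ae_eq_sym.
rewrite [LHS](Fubini iF).
have iG := integrable_line_cube_dual mphi phi1 phi0.
rewrite [RHS](Fubini iG).
apply: ae_eq_integral => //.
- exact: (measurable_fubini_G iF).
- exact: (measurable_fubini_G iG).
have := ae_integrable2 iG; apply: filterS => t iGt _.
rewrite /fubini_G/= -(integral_shift (t *: y) iGt).
by apply: eq_integral => x _; rewrite /= addrK.
Qed.
End line_average.

(** * The fundamental theorem of calculus for weak derivatives *)
Section weak_ftc.
Context {R : realType} {n : nat}.
Local Notation mu := (@lebesgue_rV R n).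
Local Notation unif := (uniform_prob (@ltr01 R)).
Implicit Types u v : 'rV[R]_n -> R.

(** Weak derivatives tested only against tensor products.  Two consecutive weak
    derivatives of a function are related in this sense ([weak_deriv_tensor]),
    whatever representatives are chosen. *)
Definition tensor_weak_deriv (i : 'I_n) u v :=
  [/\ loc_integrable u, loc_integrable v &
    forall g : 'I_n -> R -> R, (forall j, test1 (g j)) ->
      \int[mu]_x (u x * tensor (subst_factor g i (derive1 (g i))) x) =
      - \int[mu]_x (v x * tensor g x)].

Lemma test1_subst_factor (g : 'I_n -> R -> R) i f : (forall j, test1 (g j)) -> test1 f ->
  forall j, test1 (subst_factor g i f j).
Proof. by move=> tg tf j; rewrite /subst_factor; case: ifP. Qed.

Lemma subst_factor_subst (g : 'I_n -> R -> R) i f f' :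
  subst_factor (subst_factor g i f) i f' = subst_factor g i f'.
Proof. by apply/funext => j; rewrite /subst_factor; case: eqP. Qed.

Lemma subst_factorE (g : 'I_n -> R -> R) i f : subst_factor g i f i = f.
Proof. by rewrite /subst_factor eqxx. Qed.

Lemma weak_deriv_tensor i m u v w : is_weak_deriv (mindex1 i m) u v ->
  is_weak_deriv (mindex1 i m.+1) u w -> tensor_weak_deriv i v w.
Proof.
move=> [_ lv vE] [_ lw wE]; split=> // g tg.
have tg' : forall j, test1 (subst_factor g i (derive1 (g i)) j).
  by apply: test1_subst_factor => //; exact: test1_derive1.
have sgi : smooth1 (g i) by have [] := tg i.
have := vE _ (test_function_tensor tg').
have := wE _ (test_function_tensor tg).
rewrite !mderiv_mindex1 !mdegree_mindex1 iterSr pderiv_tensor// =>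
  -> /(congr1 ( *%R ((-1) ^+ m))).
rewrite !mulrA -!exprD -signr_odd addnS/= addnn odd_double/= expr1 mulN1r.
by rewrite -[X in _ = X * _]signr_odd odd_double expr0 mul1r.
Qed.

Lemma is_weak_deriv0 i u : loc_integrable u -> is_weak_deriv (mindex1 i 0) u u.
Proof.
move=> lu; split=> // phi tphi.
by rewrite mderiv_mindex1 mdegree_mindex1 expr0 mul1r.
Qed.

(** Let [phi] be a product of bumps and [psi] the product obtained by replacing its
    [i]-th factor by [avg_primitive].  The [i]-th derivative of [psi] is
    [phi x - phi (x - h e_i)], so the increment of [u] tested against [phi] is
    minus [u] tested against this derivative, that is, [v] tested against [psi].
    But [psi x] is [h] times the average of [phi (x - t h e_i)], and
    [line_average_duality] moves the average onto [v]. *)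
Theorem weak_deriv_increment i u v (h : R) : tensor_weak_deriv i u v ->
  {ae mu, forall x, u (x + h *: delta_mx ord0 i) - u x =
    h * line_average v (h *: delta_mx ord0 i) x}.
Proof.
move=> [/loc_integrable_cube cu /loc_integrable_cube cv uv].
set y := h *: delta_mx ord0 i.
have cV := cube_integrable_line_average y cv.
pose w x := u (x + y) - u x - h * line_average v y x.
have cuy := cube_integrable_shift y cu.
have chV := cube_integrableZ h cV.
have cw : cube_integrable w.
  by apply: cube_integrableB => //; exact: cube_integrableB.
suff : {ae mu, forall x, w x = 0}.
  by apply: filterS => x /eqP; rewrite subr_eq0 => /eqP.
apply: (du_bois_reymond cw) => k a b.
pose g j := bumpf k.+1%:R (a j) (b j).
have k0 : 0 < k.+1%:R :> R by [].
have tg j : test1 (g j) by exact: test1_bump.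
have g0 x : 0 <= g i x by exact: bump_ge0.
(* psi is subst_factor g i zeta *)
pose zeta := avg_primitive (g i) h.
have tz : test1 zeta by exact: test1_avg_primitive.
have dz : derive1 zeta = (fun s => g i s - g i (s - h)).
  by apply: is_derive_derive1 => s; exact: is_derive_avg_primitive.
have uvz := uv _ (test1_subst_factor i tg tz).
rewrite subst_factor_subst subst_factorE dz in uvz.
have tyE x : tensor (subst_factor g i (fun s => g i s - g i (s - h))) x =
    tensor g x - tensor g (x - y).
  rewrite tensor_subst_factor mulrBl (tensorD1 g i x) (tensorD1 g i (x - y)); congr (_ - _).
  rewrite !mxE !eqxx/= mulr1; congr (_ * _).
  apply: eq_bigr => j ji; rewrite !mxE eqxx (negbTE ji)/= mulr0 subr0//.
have itg f : cube_integrable f -> mu.-integrable setT (EFin \o (fun x => f x * tensor g x)).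
  by move=> cf; exact: integrable_tensor_bump.
have mtg : measurable_fun setT (tensor g) by exact: measurable_tensor_bump.
have tg1 x : `|tensor g x| <= 1.
  by rewrite ger0_norm ?tensor_bump_le1// tensor_bump_ge0.
have [r abr] := openbox_sub_cube a b.
have tg0 x : ~ cube r x -> tensor g x = 0.
  by move=> xr; apply: tensor_bump0 => // /abr.
have uE : \int[mu]_x (u x * tensor (subst_factor g i (fun s => g i s - g i (s - h))) x) =
    \int[mu]_x (u x * tensor g x) - \int[mu]_x (u (x + y) * tensor g x).
  under eq_Rintegral do rewrite tyE mulrBr.
  have iuy : mu.-integrable setT (EFin \o (fun x => u x * tensor g (x - y))).
    have := integrable_shift (- y) (itg _ cuy).
    by under [X in _.-integrable _ X]eq_fun do rewrite /= subrK.
  have shiftE : \int[mu]_x (u x * tensor g (x - y)) = \int[mu]_x (u (x + y) * tensor g x).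
    rewrite /Rintegral -(integral_shift y iuy) /=.
    by under eq_integral do rewrite addrK.
  by rewrite (RintegralB measurableT (itg _ cu) iuy) shiftE.
have vE : \int[mu]_x (v x * tensor (subst_factor g i zeta) x) =
    h * \int[mu]_x (line_average v y x * tensor g x).
  rewrite /Rintegral (line_average_duality y cv mtg tg1 tg0).
  have iG := integrable_fubini_F (integrable_line_cube_dual y cv mtg tg1 tg0).
  rewrite -[X in _ = X * _]/(fine h%:E) -fineM//; last exact: integrable_fin_num.
  rewrite -integralZl//; congr fine; apply: eq_integral => x _.
  set P := \prod_(j | j != i) g j (x ord0 j).
  have mgi : measurable_fun setT (fun t : measurableTypeR R => (g i (x ord0 i - t * h))%:E).
    apply/measurable_EFinP; apply: continuous_measurable_fun.
    have := smooth1_continuous (smooth1_affine (- h) (x ord0 i) (tg i).1).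
    by under eq_fun do rewrite mulNr addrC mulrC.
  have igi : unif.-integrable setT (fun t : measurableTypeR R => (g i (x ord0 i - t * h))%:E).
    apply/integrableP; split => //; apply: (@le_lt_trans _ _ 1%E); last exact: ltry.
    apply: integral_unif_le => [|t|t _].
    - exact: measurableT_comp.
    - exact: abse_ge0.
    - by rewrite /= lee_fin ger0_norm ?bump_le1.
  have -> : (\int[unif]_t (v x * tensor g (x - t *: y))%:E =
      \int[unif]_t ((v x * P)%:E * (g i (x ord0 i - t * h))%:E))%E.
    apply: eq_integral => t _; rewrite -EFinM; congr (_%:E).
    rewrite (tensorD1 g i) !mxE !eqxx/= mulr1.
    rewrite [in RHS]mulrAC -mulrA; congr (_ * (_ * _)).
    by apply: eq_bigr => j ji; rewrite !mxE eqxx (negbTE ji)/= mulr0 mulr0 subr0.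
  rewrite integralZl// -[X in (_ * (_ * X))%E]fineK; last exact: integrable_fin_num.
  rewrite -!EFinM; congr (_%:E).
  by rewrite tensor_subst_factor -/P /zeta /avg_primitive; ring.
have iu := itg _ cu; have iuy := itg _ cuy; have iV := itg _ cV; have ihV := itg _ chV.
have -> : \int[mu]_x (w x * tensor g x) = \int[mu]_x (u (x + y) * tensor g x)
    - \int[mu]_x (u x * tensor g x) - h * \int[mu]_x (line_average v y x * tensor g x).
  under eq_Rintegral do rewrite /w mulrBl mulrBl -mulrA.
  have ihV' : mu.-integrable setT (EFin \o (fun x => h * (line_average v y x * tensor g x))).
    by under [X in _.-integrable _ X]eq_fun do rewrite /= mulrA.
  rewrite (RintegralB measurableT (integrableB measurableT iuy iu) ihV').
  by rewrite (RintegralB measurableT iuy iu) (RintegralZl _ measurableT iV).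
have alg (A B C : R) : A - B = - C -> B - A - C = 0.
  by move=> H; rewrite -(opprB A) H opprK subrr.
by apply: alg; rewrite -uE -vE.
Qed.
End weak_ftc.

(** * The p-th power of the norm *)
Section jensen.
Context {R : realType}.
Local Notation unif := (uniform_prob (@ltr01 R)).
Variables (p : R) (p1 : 1 < p).

(** Hoelder's inequality against the constant 1 on a probability space. *)
Lemma jensen_powR (f : R -> R) : unif.-integrable setT (EFin \o f) ->
  ((`|fine (\int[unif]_t (f t)%:E)| `^ p)%:E <= \int[unif]_t (`|f t| `^ p)%:E)%E.
Proof.
move=> iF; have p0 : 0 < p by rewrite (lt_trans _ p1).
have mf : measurable_fun [set: measurableTypeR R] f.
  by apply/measurable_EFinP; exact: measurable_int iF.
(* the conjugate exponent *)
have [q q0 pq] : exists2 q : R, 0 < q & p^-1 + q^-1 = 1.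
  exists (1 - p^-1)^-1; last by rewrite invrK subrKC.
  by rewrite invr_gt0 subr_gt0 invf_lt1.
have m1 : measurable_fun [set: measurableTypeR R] (cst 1 : R -> R).
  exact: measurable_cst.
have := @hoelder _ _ _ unif f (cst 1) p q mf m1 p0 q0 pq.
have -> : ('N[unif]_q%:E[EFin \o cst 1%R] = 1)%E.
  have := Lnorm_cst1 unif q; have /= -> := @probability_setT _ _ _ unif.
  by rewrite poweR1r.
rewrite mule1 Lnorm1 => H.
have {}H : (`|\int[unif]_t (f t)%:E| <= 'N[unif]_p%:E[EFin \o f])%E.
  apply: le_trans H; apply: (le_trans (le_abse_integral _ _ _)) => //.
    exact: measurable_int iF.
  by under [leRHS]eq_integral do rewrite /= mulr1.
have fin : (\int[unif]_t (f t)%:E)%E \is a fin_num by exact: integrable_fin_num.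
have LE : ('N[unif]_p%:E[EFin \o f] `^ p = \int[unif]_t (`|f t| `^ p)%:E)%E.
  exact: (poweR_Lnorm unif (EFin \o f) (lt0r_neq0 p0)).
rewrite -LE -poweR_EFin.
apply: gt0_ler_poweR => //; rewrite ?in_itv/= ?leey ?andbT ?lee_fin//.
- exact: ltW.
- exact: Lnorm_ge0.
- by rewrite -abse_EFin fineK.
Qed.
End jensen.

Section pint.
Context {R : realType} {n : nat}.
Local Notation mu := (@lebesgue_rV R n).
Local Notation unif := (uniform_prob (@ltr01 R)).
Variables (p : R) (p1 : 1 < p).
Implicit Types (f g : 'rV[R]_n -> R).

(** The [p]-th power of the [L^p] norm, with values in the extended reals so that
    Tonelli's theorem applies without integrability conditions. *)
Definition pint f : \bar R := (\int[mu]_x (`|f x| `^ p)%:E)%E.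

Let p0 : 0 < p. Proof. by rewrite (lt_trans _ p1). Qed.

Lemma pint_ge0 f : (0 <= pint f)%E.
Proof. by apply: integral_ge0 => x _; rewrite lee_fin powR_ge0. Qed.

Lemma measurable_norm_powR d (T : measurableType d) (f : T -> R) :
  measurable_fun setT f -> measurable_fun setT (fun x => (`|f x| `^ p)%:E).
Proof.
move=> mf; apply/measurable_EFinP; apply: (measurableT_comp (measurable_powR p)).
exact: (measurableT_comp (@normr_measurable R setT)).
Qed.

Lemma Lnorm_pint f : Lnorm mu p%:E (EFin \o f) = (pint f `^ p^-1)%E.
Proof.
by rewrite unlock; congr poweR; apply: eq_integral => x _; rewrite /= poweR_EFin.
Qed.

Lemma le_pint f g : measurable_fun setT f -> measurable_fun setT g ->
  {ae mu, forall x, `|f x| <= `|g x|} -> (pint f <= pint g)%E.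
Proof.
move=> mf mg fg; apply: ae_ge0_le_integral => //.
- exact: measurable_norm_powR.
- exact: measurable_norm_powR.
- apply: filterS fg => x fgx _; rewrite lee_fin.
  by apply: ge0_ler_powR; rewrite ?nnegrE// ltW.
Qed.

Lemma eq_pint f g : measurable_fun setT f -> measurable_fun setT g ->
  {ae mu, forall x, f x = g x} -> pint f = pint g.
Proof.
move=> mf mg fg; apply/le_anti/andP; split; apply: le_pint => //;
  by apply: filterS fg => x ->.
Qed.

Lemma pint_shift f (y : 'rV[R]_n) : measurable_fun setT f ->
  pint (fun x => f (x + y)) = pint f.
Proof.
move=> mf; apply: (ge0_integral_shift y (f := fun x => (`|f x| `^ p)%:E)).
  exact: measurable_norm_powR.
by move=> x; rewrite lee_fin powR_ge0.
Qed.

Lemma pintZ c f : measurable_fun setT f ->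
  pint (fun x => c * f x) = ((`|c| `^ p)%:E * pint f)%E.
Proof.
move=> mf; rewrite /pint -ge0_integralZl//.
- by apply: eq_integral => x _; rewrite normrM powRM.
- exact: measurable_norm_powR.
Qed.

Lemma pintN f : pint (fun x => - f x) = pint f.
Proof. by apply: eq_integral => x _; rewrite normrN. Qed.

Lemma normD_powR (a b : R) :
  `|a + b| `^ p <= 2 `^ p * (`|a| `^ p + `|b| `^ p).
Proof.
have le (a' b' : R) : `|a'| <= `|b'| -> `|a' + b'| `^ p <= 2 `^ p * `|b'| `^ p.
  move=> ab; rewrite -powRM//; apply: ge0_ler_powR; rewrite ?nnegrE ?mulr_ge0//.
    exact: ltW.
  by apply: (le_trans (ler_normD _ _)); rewrite mulr2n mulrDl mul1r lerD2r.
have [ab|ba] := leP `|a| `|b|.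
  by apply: (le_trans (le _ _ ab)); rewrite ler_wpM2l ?powR_ge0// lerDr powR_ge0.
rewrite addrC; apply: (le_trans (le _ _ (ltW ba))).
by rewrite ler_wpM2l ?powR_ge0// lerDl powR_ge0.
Qed.

Lemma pintD f g : measurable_fun setT f -> measurable_fun setT g ->
  (pint (fun x => f x + g x)%R <= (2 `^ p)%:E * (pint f + pint g))%E.
Proof.
move=> mf mg.
have mfp := measurable_norm_powR mf; have mgp := measurable_norm_powR mg.
rewrite /pint -ge0_integralD//; [|by move=> x _; rewrite lee_fin powR_ge0..].
rewrite -ge0_integralZl//; last 2 first.
- by apply: emeasurable_funD.
- by move=> x _; rewrite adde_ge0// lee_fin powR_ge0.
apply: ge0_le_integral => //.
- by apply: measurable_norm_powR; exact: measurable_funD.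
- apply: emeasurable_funM => //; exact: emeasurable_funD.
- by move=> x _; rewrite -EFinD -EFinM lee_fin normD_powR.
Qed.

(** A weak form of Minkowski's integral inequality, with the supremum over [t]
    instead of the average. *)
Lemma pint_average_le (D : 'rV[R]_n -> R) (F : 'rV[R]_n * R -> R) B :
  measurable_fun setT D ->
  measurable_fun [set: 'rV[R]_n * measurableTypeR R] F ->
  {ae mu, forall x, unif.-integrable setT (fun t : measurableTypeR R => (F (x, t))%:E) /\
    D x = fine (\int[unif]_t (F (x, t))%:E)%E} ->
  (forall t, 0 <= t <= 1 -> (pint (fun x => F (x, t)) <= B)%E) ->
  (pint D <= B)%E.
Proof.
move=> mD mF DF FB.
have mFp := measurable_norm_powR mF.
have Fp0 z : (0 <= (`|F z| `^ p)%:E)%E by rewrite lee_fin powR_ge0.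
apply: (@le_trans _ _ (\int[mu]_x \int[unif]_t (`|F (x, t)| `^ p)%:E)%E).
  apply: ae_ge0_le_integral => //.
  - exact: measurable_norm_powR.
  - by move=> x _; apply: integral_ge0.
  - exact: (@measurable_fun_fubini_tonelli_F _ _ _ _ _ unif (fun z => (`|F z| `^ p)%:E)).
  - apply: filterS DF => x [iF ->] _; exact: (jensen_powR p1 iF).
rewrite (@fubini_tonelli _ _ _ _ _ mu unif (fun z => (`|F z| `^ p)%:E))//.
apply: integral_unif_le.
- exact: (@measurable_fun_fubini_tonelli_G _ _ _ _ _ mu (fun z => (`|F z| `^ p)%:E)).
- by move=> t; apply: integral_ge0.
- exact: FB.
Qed.

End pint.

(** * Increments and the Gagliardo seminorm *)
Section nikolskii.
Context {R : realType} {n : nat}.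
Local Notation mu := (@lebesgue_rV R n).
Variables (p : R) (p1 : 1 < p).
Implicit Types (v : 'rV[R]_n -> R).

Let p0 : 0 < p. Proof. by rewrite (lt_trans _ p1). Qed.

Definition increment v (z : 'rV[R]_n) : \bar R := pint p (fun x => v (x + z) - v x).

Lemma increment_ge0 v z : (0 <= increment v z)%E.
Proof. exact: pint_ge0. Qed.

Lemma measurable_rV_addp : measurable_fun [set: 'rV[R]_n * 'rV[R]_n] (fun z => z.1 + z.2).
Proof.
apply: measurable_fun_rV => i; under eq_fun do rewrite mxE.
apply: measurable_funD.
  exact: (measurableT_comp (measurable_coord i) measurable_fst).
exact: (measurableT_comp (measurable_coord i) measurable_snd).
Qed.

Lemma measurable_increment_integrand v : measurable_fun setT v ->
  measurable_fun [set: 'rV[R]_n * 'rV[R]_n] (fun z => v (z.1 + z.2) - v z.1).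
Proof.
move=> mv; apply: measurable_funB.
  exact: (measurableT_comp mv measurable_rV_addp).
exact: (measurableT_comp mv measurable_fst).
Qed.

Lemma measurable_increment v : measurable_fun setT v -> measurable_fun setT (increment v).
Proof.
move=> mv.
apply: (@measurable_fun_fubini_tonelli_G _ _ _ _ _ mu
  (fun z => (`|v (z.1 + z.2) - v z.1| `^ p)%:E)).
- by apply: measurable_norm_powR; exact: measurable_increment_integrand.
- by move=> z; rewrite lee_fin powR_ge0.
Qed.

Lemma increment0 v : increment v 0 = 0%E.
Proof.
rewrite /increment /pint -[RHS](@integral0 _ _ _ mu setT).
by apply: eq_integral => x _; rewrite addr0 subrr normr0 powR0// lt0r_neq0.
Qed.

Lemma measurable_enorm : measurable_fun setT (@enorm R n).
Proof.
have msqrt : measurable_fun setT (@Num.sqrt R).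
  by apply: continuous_measurable_fun; exact: sqrt_continuous.
apply: (measurableT_comp msqrt).
apply: (@measurable_sum _ _ _ _ _
  (index_enum 'I_n) (fun i (x : 'rV[R]_n) => x ord0 i ^+ 2)) => i.
by apply: measurable_funX; exact: measurable_coord.
Qed.

Lemma measurable_inv_enorm (al : R) :
  measurable_fun setT (fun z : 'rV[R]_n => (enorm z `^ al)^-1).
Proof.
rewrite (_ : (fun _ => _) = (fun z => enorm z `^ (- al))).
  exact: (measurableT_comp (measurable_powR _) measurable_enorm).
by apply/funext => z; rewrite powRN.
Qed.

(** Substituting [x = y + z] and exchanging the integrals. *)
Lemma gagliardo_increment sigma v : measurable_fun setT v ->
  (\int[mu]_y \int[mu]_x (`|v x - v y| `^ p / enorm (x - y) `^ (n%:R + sigma * p))%:E =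
   \int[mu]_z (increment v z * ((enorm z `^ (n%:R + sigma * p))^-1)%:E))%E.
Proof.
move=> mv; set al := n%:R + sigma * p.
pose F (z : 'rV[R]_n * 'rV[R]_n) := (`|v (z.1 + z.2) - v z.1| `^ p / enorm z.2 `^ al)%:E.
have men := measurable_inv_enorm al.
have mF : measurable_fun setT F.
  apply/measurable_EFinP; apply: measurable_funM;
    last exact: (measurableT_comp men measurable_snd).
  by apply/measurable_EFinP/measurable_norm_powR; exact: measurable_increment_integrand.
have F0 z : (0 <= F z)%E by rewrite lee_fin mulr_ge0 ?invr_ge0 ?powR_ge0.
transitivity (\int[mu]_y \int[mu]_z F (y, z))%E.
  apply: eq_integral => y _.
  pose H (x : 'rV[R]_n) := (`|v x - v y| `^ p / enorm (x - y) `^ al)%:E.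
  have mH : measurable_fun setT H.
    apply/measurable_EFinP; apply: measurable_funM.
      by apply/measurable_EFinP/measurable_norm_powR; exact: measurable_funB.
    by apply: (measurableT_comp men); exact: measurable_rV_add.
  have H0 x : (0 <= H x)%E by rewrite lee_fin mulr_ge0 ?invr_ge0 ?powR_ge0.
  rewrite -[LHS](ge0_integral_shift y mH H0).
  by apply: eq_integral => z _; rewrite /F/H/= addrK (addrC y).
rewrite (@fubini_tonelli _ _ _ _ _ mu mu F mF F0); apply: eq_integral => z _.
rewrite /increment /pint -ge0_integralZr//.
- apply/measurable_norm_powR; apply: measurable_funB => //.
  by apply: (measurableT_comp mv); exact: measurable_rV_add.
- by rewrite lee_fin invr_ge0 powR_ge0.
Qed.

(** Going from [x] to [x + y] through [x + w]; the second step is a translate of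
    the increment along [w - y], up to sign. *)
Lemma increment_triangle v y w : measurable_fun setT v ->
  (increment v y <= (2 `^ p)%:E * (increment v w + increment v (w - y)))%E.
Proof.
move=> mv.
have mvs (z : 'rV[R]_n) : measurable_fun setT (fun x : 'rV[R]_n => v (x + z)).
  by apply: (measurableT_comp mv); exact: measurable_rV_add.
have -> : increment v (w - y) = pint p (fun x => v (x + y) - v (x + w)).
  rewrite -[LHS](pint_shift p y) ; last exact: measurable_funB.
  rewrite -[RHS]pintN; congr pint; apply/funext => x.
  by rewrite opprB addrACA subrr addr0.
have -> : increment v y = pint p (fun x => (v (x + w) - v x) + (v (x + y) - v (x + w))).
  by congr pint; apply/funext => x; rewrite [RHS]addrC addrA subrK.
by apply: pintD => //; exact: measurable_funB.
Qed.

Lemma enorm_le (r : R) (z : 'rV[R]_n) : 0 <= r -> cube r z -> enorm z <= n%:R * r.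
Proof.
move=> r0 zr; rewrite /enorm -(ger0_norm (x := n%:R * r)) ?mulr_ge0// -sqrtr_sqr.
rewrite ler_sqrt ?sqr_ge0//.
apply: (@le_trans _ _ (\sum_(i < n) r ^+ 2)).
  by apply: ler_sum => i _; rewrite -[_ ^+ 2]real_normK ?num_real// ler_pXn2r ?nnegrE// ltW.
rewrite sumr_const card_ord exprMn -[X in X <= _]mulr_natl ler_wpM2r ?sqr_ge0// -natrX ler_nat.
by case: n => // m; rewrite expnS leq_pmulr// expn_gt0.
Qed.

Lemma enorm_gt0 (z : 'rV[R]_n) : z != 0 -> 0 < enorm z.
Proof.
move=> z0; rewrite sqrtr_gt0 lt0r sumr_ge0 ?andbT; last by move=> i _; exact: sqr_ge0.
apply: contraNN z0; rewrite psumr_eq0; last by move=> i _; exact: sqr_ge0.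
move=> /allP h; apply/eqP/rowP => i; rewrite mxE.
by apply/eqP; rewrite -sqrf_eq0; exact: h (mem_index_enum i).
Qed.

(** Integrate [increment_triangle] over [w] in the cube of radius [r]; both [w] and
    [w - y] then stay in the cube of radius [2 * r]. *)
Lemma increment_le_integral v (y : 'rV[R]_n) (r : R) : measurable_fun setT v -> 0 < r ->
  (forall i, `|y ord0 i| <= r) ->
  (((2 * r) ^+ n)%:E * increment v y <=
    (2 `^ p * 2)%:E * \int[mu]_(z in cube (2 * r)) increment v z)%E.
Proof.
move=> mv r0 yr.
have mr := @measurable_cube R n r; have m2r := @measurable_cube R n (2 * r).
have mI := measurable_increment mv.
have I0 z : (0 <= increment v z)%E by exact: increment_ge0.
have tri w := increment_triangle y w mv.
move: (increment v) mI I0 tri => I mI I0 tri.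
have mIs : measurable_fun setT (fun w : 'rV[R]_n => I (w - y)%R).
  by apply: (measurableT_comp mI); exact: measurable_rV_add.
have -> : (((2 * r) ^+ n)%:E * I y = \int[mu]_(w in cube r) (I y))%E.
  rewrite integral_cst// muleC; congr (_ * _)%E.
  exact/esym/lebesgue_rV_cube.
apply: (@le_trans _ _ (\int[mu]_(w in cube r)
    ((2 `^ p)%:E * (I w + I (w - y)%R)))%E).
  have mS : measurable_fun setT (fun w : 'rV[R]_n => (2 `^ p)%:E * (I w + I (w - y)%R))%E.
    apply: (emeasurable_funM (measurable_cst _)); exact: (emeasurable_funD mI mIs).
  apply: ge0_le_integral => //; first exact: (measurable_funTS mS).
rewrite ge0_integralZl//; last 2 first.
- exact: (measurable_funTS (emeasurable_funD mI mIs)).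
- by move=> w _; rewrite adde_ge0.
rewrite EFinM -muleA lee_pmul2l ?lte_fin ?powR_gt0//.
rewrite ge0_integralD//; [|exact: measurable_funTS..].
rewrite mule_natl mule2n; apply: leeD.
  apply: ge0_subset_integral => //; first exact: measurable_funTS.
  by apply: cube_sub; rewrite mulr2n mulrDl mul1r lerDl ltW.
rewrite integral_mkcond [leRHS]integral_mkcond.
pose H := (fun w => I (w - y)%R) \_ (cube r).
have mH : measurable_fun setT H.
  exact: (measurable_restrictT _ mr).1 (measurable_funTS mIs).
have H0 w : (0 <= H w)%E by apply: erestrict_ge0 => ? _.
rewrite -[leLHS](ge0_integral_shift y mH H0); apply: ge0_le_integral => //.
- by apply: (measurableT_comp mH); exact: measurable_rV_add.
- exact: (measurable_restrictT _ m2r).1 (measurable_funTS mI).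
move=> w _; rewrite /H !patchE addrK; case: ifPn => [|_]; last first.
  by case: ifPn.
rewrite inE => wyr; rewrite mem_set// => i.
have := wyr i; rewrite mxE => wi.
rewrite -(addrK (y ord0 i) (w ord0 i)); apply: (le_lt_trans (ler_normB _ _)).
by rewrite mulr2n mulrDl mul1r ltr_leD.
Qed.

(** On the cube the weight [enorm z `^ al] is at most [(n r) `^ al].  At [z = 0] the
    inverse weight is not large (its value is [0^-1 = 0] when [al] is nonzero), but
    there the increment vanishes. *)
Lemma integral_increment_cube v al (r : R) : measurable_fun setT v -> 0 < r -> 0 <= al ->
  (0 < n)%N ->
  (\int[mu]_(z in cube r) increment v z <= ((n%:R * r) `^ al)%:E *
    \int[mu]_z (increment v z * ((enorm z `^ al)^-1)%:E))%E.
Proof.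
move=> mv r0 al0 n0.
have mr := @measurable_cube R n r.
have mI := measurable_increment mv.
have I0 z : (0 <= increment v z)%E by exact: increment_ge0.
have men := measurable_inv_enorm al.
have mJ : measurable_fun setT (fun z => increment v z * ((enorm z `^ al)^-1)%:E)%E.
  by apply: emeasurable_funM => //; exact/measurable_EFinP.
have J0 z : (0 <= increment v z * ((enorm z `^ al)^-1)%:E)%E.
  by rewrite mule_ge0// lee_fin invr_ge0 powR_ge0.
rewrite -ge0_integralZl// ?lee_fin ?powR_ge0//.
rewrite [leLHS]integral_mkcond; apply: ge0_le_integral => //.
- by move=> z _; exact: erestrict_ge0.
- exact: (measurable_restrictT _ mr).1 (measurable_funTS mI).
- by apply: emeasurable_funM.
move=> z _; rewrite patchE; case: ifPn; last by rewrite mule_ge0// lee_fin powR_ge0.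
rewrite inE => zr; have [->|z0] := eqVneq z 0.
  by rewrite increment0 mul0e mule0.
have ez := enorm_gt0 z0.
rewrite muleCA; rewrite -[leLHS]mule1; apply: lee_wpmul2l => //.
rewrite -EFinM lee_fin ler_pdivlMr ?powR_gt0// mul1r.
apply: ge0_ler_powR; rewrite ?nnegrE ?mulr_ge0 ?(ltW ez) ?(ltW r0)//.
by apply: enorm_le => //; exact: ltW.
Qed.

End nikolskii.

(** * From averages to seminorms *)
Section frac_increment.
Context {R : realType} {n : nat}.
Local Notation mu := (@lebesgue_rV R n).
Local Notation unif := (uniform_prob (@ltr01 R)).
Local Notation "'e_ i" := (delta_mx ord0 i : 'rV[R]_n) (at level 8, i at level 2).
Variables (p : R) (p1 : 1 < p).
Implicit Types (u v w : 'rV[R]_n -> R).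

Let p0 : 0 < p. Proof. by rewrite (lt_trans _ p1). Qed.

(** The only way in which the representation formula is used below.  The sign
    [eps] and the correction [kap t * gam x], with [k1] the average of [kap],
    cover the first difference ([eps = 0]), the symmetric first difference
    ([eps = -1]) and the central second difference ([eps = 1]). *)
Lemma pint_increment_le i u v (h eps k1 : R) (gam : 'rV[R]_n -> R) (kap : R -> R) B :
  tensor_weak_deriv i u v -> measurable_fun setT gam ->
  measurable_fun [set: measurableTypeR R] kap ->
  unif.-integrable setT (fun t : measurableTypeR R => (kap t)%:E) ->
  fine (\int[unif]_t (kap t)%:E)%E = k1 ->
  (forall t, 0 <= t <= 1 -> (pint p (fun x => v (x + t *: (h *: 'e_ i))
     - eps * v (x + t *: (- h *: 'e_ i)) - kap t * gam x)%R <= B)%E) ->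
  (pint p (fun x => (u (x + h *: 'e_ i) - u x) + eps * (u (x + - h *: 'e_ i) - u x)
     - h * (k1 * gam x))%R <= (`|h| `^ p)%:E * B)%E.
Proof.
move=> uv mgam mkap ikap kapE FB.
have [/loc_integrable_cube[mu_ iu] /loc_integrable_cube cv _] := uv.
have mv := cv.1.
pose y : 'rV[R]_n := h *: 'e_ i; pose y' : 'rV[R]_n := - h *: 'e_ i.
have mV := measurable_line_average y cv; have mV' := measurable_line_average y' cv.
pose D x := line_average v y x - eps * line_average v y' x - k1 * gam x.
have mD : measurable_fun setT D.
  apply: measurable_funB; last exact: measurable_funM.
  by apply: measurable_funB => //; exact: measurable_funM.
have mus (z : 'rV[R]_n) : measurable_fun setT (fun x : 'rV[R]_n => u (x + z)).
  by apply: (measurableT_comp mu_); exact: measurable_rV_add.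
rewrite (eq_pint (g := fun x => h * D x) p1).
- rewrite pintZ//; apply: lee_wpmul2l; first by rewrite lee_fin powR_ge0.
  pose F (z : 'rV[R]_n * R) := v (z.1 + z.2 *: y) - eps * v (z.1 + z.2 *: y')
    - kap z.2 * gam z.1.
  apply: (@pint_average_le _ _ _ p1 D F) => //.
  + apply: measurable_funB; last first.
      apply: measurable_funM; first exact: (measurableT_comp mkap measurable_snd).
      exact: (measurableT_comp mgam measurable_fst).
    apply: measurable_funB; first exact: measurable_along_line.
    apply: measurable_funM => //; exact: measurable_along_line.
  + have := ae_integrable_line y' cv; have := ae_integrable_line y cv.
    apply: filterS2 => x iv iv'.
    have iv2 := integrableZl measurableT eps iv'.
    have ik2 := integrableZr measurableT (gam x) ikap.
    have i12 := integrableB measurableT iv iv2.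
    split; first exact: (integrableB measurableT i12 ik2).
    rewrite /D /line_average -kapE.
    apply/esym/(etrans (@RintegralB _ _ _ unif setT _ _ measurableT i12 ik2)).
    rewrite (@RintegralB _ _ _ unif setT _ _ measurableT iv iv2).
    rewrite (@RintegralZl _ _ _ unif setT _ eps measurableT iv').
    by rewrite (@RintegralZr _ _ _ unif setT _ (gam x) measurableT ikap).
- apply: measurable_funB; last by apply: measurable_funM => //; exact: measurable_funM.
  apply: measurable_funD; first exact: measurable_funB.
  by apply: measurable_funM => //; exact: measurable_funB.
- exact: measurable_funM.
have := weak_deriv_increment h uv; have := weak_deriv_increment (- h) uv.
apply: filterS2 => x -> ->; rewrite /D -/y -/y'; ring.
Qed.

Lemma pint_line_average_le (v : 'rV[R]_n -> R) y : cube_integrable v ->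
  (pint p (line_average v y) <= pint p v)%E.
Proof.
move=> cv.
apply: (@pint_average_le _ _ _ p1 _ (fun z => v (z.1 + z.2 *: y))).
- exact: measurable_line_average.
- exact: measurable_along_line.
- by apply: filterS (ae_integrable_line y cv) => x iv.
- by move=> t _ /=; rewrite pint_shift//; exact: cv.1.
Qed.

Lemma poweRVK (X : \bar R) : (0 <= X)%E -> ((X `^ p^-1) `^ p = X)%E.
Proof. by move=> X0; rewrite -poweRrM mulVf ?lt0r_neq0// poweRe1. Qed.

(** The powers of [r] balance: the volume of the cube contributes [r ^ - n] and the
    weight contributes [r ^ (n + sigma p)]. *)
Lemma increment_gagliardo_le sigma : 0 < sigma < 1 -> (0 < n)%N ->
  exists2 C : R, 0 < C & forall v, measurable_fun setT v ->
    forall (y : 'rV[R]_n) (r : R), 0 < r -> (forall j, `|y ord0 j| <= r) ->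
    (increment p v y <= (C * r `^ (sigma * p))%:E *
       gagliardo_seminorm sigma p v `^ p)%E.
Proof.
move=> /andP[s0 s1] n0; pose al := n%:R + sigma * p.
have al0 : 0 <= al by rewrite addr_ge0// mulr_ge0 ?ltW.
have ss : 0 < sigma * (1 - sigma) by rewrite mulr_gt0// subr_gt0.
have nr : 0 < n%:R :> R by rewrite ltr0n.
pose C := 2 `^ p * 2 * (n%:R * 2) `^ al / 2 ^+ n / (sigma * (1 - sigma)).
exists C.
  by rewrite /C !divr_gt0// !mulr_gt0 ?powR_gt0 ?mulr_gt0// exprn_gt0.
move=> v mv y r r0 yr.
pose K := (\int[mu]_z (increment p v z * ((enorm z `^ al)^-1)%:E))%E.
have K0 : (0 <= K)%E.
  apply: integral_ge0 => z _; rewrite mule_ge0 ?increment_ge0//.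
  by rewrite lee_fin invr_ge0 powR_ge0.
have -> : (gagliardo_seminorm sigma p v `^ p = (sigma * (1 - sigma))%:E * K)%E.
  rewrite /gagliardo_seminorm (gagliardo_increment p sigma mv) poweRVK//.
  by rewrite mule_ge0// lee_fin ltW.
have r2 : 0 < 2 * r by rewrite mulr_gt0.
have H := increment_le_integral p1 mv r0 yr.
have H' := integral_increment_cube p1 mv r2 al0 n0.
have r2n : 0 < (2 * r) ^+ n by rewrite exprn_gt0.
have {H}H : ((((2 * r) ^+ n)%:E * increment p v y <=
    (2 `^ p * 2)%:E * (((n%:R * (2 * r)) `^ al)%:E * K))%E).
  by apply: (le_trans H); apply: lee_wpmul2l.
have {}H : (increment p v y <= (((2 * r) ^+ n)^-1)%:E *
    ((2 `^ p * 2)%:E * (((n%:R * (2 * r)) `^ al)%:E * K)))%E.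
  by rewrite lee_pdivlMl.
apply: (le_trans H); rewrite !muleA -!EFinM le_eqVlt; apply/orP; left.
apply/eqP; congr (_%:E * _)%E.
have -> : n%:R * (2 * r) = (n%:R * 2) * r by rewrite mulrA.
rewrite powRM ?mulr_ge0 ?(ltW r0)//.
have -> : r `^ al = r ^+ n * r `^ (sigma * p).
  rewrite /al powRD; last by rewrite (gt_eqF r0) implybT.
  by rewrite powR_mulrn// ltW.
rewrite /C exprMn.
field.
by rewrite !lt0r_neq0 ?subr_gt0 ?exprn_gt0.
Qed.
Lemma gradient_component_le v i : weakly_differentiable v ->
  (pint p (weak_deriv (mindex1 i 1) v) <= gradient_seminorm p v `^ p)%E.
Proof.
move=> wv; rewrite /gradient_seminorm asboolT//.
have mw j : measurable_fun setT (weak_deriv (mindex1 j 1) v).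
  by have [] := xgetPex (cst 0) (wv j) => _ [].
have mg : measurable_fun setT (fun x => enorm (weak_grad v x)).
  apply: (measurableT_comp measurable_enorm); apply: measurable_fun_rV => j.
  by under eq_fun do rewrite mxE; exact: mw.
rewrite (@Lnorm_pint _ _ p (fun x => enorm (weak_grad v x))) poweRVK ?pint_ge0//.
apply: le_pint => //; apply: aeW => x.
rewrite [leRHS]ger0_norm ?sqrtr_ge0// -sqrtr_sqr ler_sqrt ?sumr_ge0//; last first.
  by move=> j _; exact: sqr_ge0.
rewrite (bigD1 i)//= mxE lerDl sumr_ge0// => j _; exact: sqr_ge0.
Qed.

Lemma increment_gradient_le v i (t : R) : weakly_differentiable v ->
  (increment p v (t *: 'e_ i) <= (`|t| `^ p)%:E * gradient_seminorm p v `^ p)%E.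
Proof.
move=> wv; have vw : is_weak_deriv (mindex1 i 1) v (weak_deriv (mindex1 i 1) v).
  exact: (xgetPex (cst 0) (wv i)).
have [lv lw _] := vw.
have tvw := weak_deriv_tensor (is_weak_deriv0 i lv) vw.
have cw := loc_integrable_cube lw.
have mv : measurable_fun setT (fun x : 'rV[R]_n => v (x + t *: 'e_ i)).
  by apply: (measurableT_comp lv.1); exact: measurable_rV_add.
have mL := measurable_line_average (t *: 'e_ i) cw.
rewrite /increment (eq_pint (g := fun x => t * line_average (weak_deriv (mindex1 i 1) v)
  (t *: 'e_ i) x) p1).
- rewrite pintZ//; apply: lee_wpmul2l; first by rewrite lee_fin powR_ge0.
  exact: le_trans (pint_line_average_le _ cw) (gradient_component_le i wv).
- exact: measurable_funB lv.1.
- exact: measurable_funM.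
- exact: weak_deriv_increment.
Qed.

(** The common form of the two cases; a function without weak gradient has
    infinite seminorm of order 1. *)
Lemma increment_frac_le sigma : 0 < sigma <= 1 -> (0 < n)%N ->
  exists2 C : R, 0 < C & forall v, measurable_fun setT v ->
    forall i (t r : R), 0 < r -> `|t| <= r ->
    (increment p v (t *: 'e_ i) <= (C * r `^ (sigma * p))%:E *
       frac_seminorm sigma p v `^ p)%E.
Proof.
move=> /andP[s0 s1] n0; rewrite /frac_seminorm; case: eqVneq => [->|sn1].
  exists 1 => // v mv i t r r0 tr; rewrite mul1r mul1r.
  have [wv|nwv] := pselect (weakly_differentiable v); last first.
    rewrite /gradient_seminorm asboolF// poweRyr ?lt0r_neq0// gt0_muley ?leey//.
    by rewrite lte_fin powR_gt0.
  apply: (le_trans (increment_gradient_le i t wv)).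
  apply: lee_wpmul2r; first exact: poweR_ge0.
  by rewrite lee_fin; apply: ge0_ler_powR; rewrite ?nnegrE// ltW.
have [|C C0 HC] := @increment_gagliardo_le sigma _ n0.
  by rewrite s0 lt_neqAle sn1.
exists C => // v mv i t r r0 tr; apply: HC => // j.
rewrite !mxE eqxx/= normrM; case: (j == i); rewrite ?normr1 ?mulr1//.
by rewrite normr0 mulr0 ltW.
Qed.

End frac_increment.

(** * Difference quotients of Sobolev functions *)
Section difference_quotients.
Context {R : realType} {n : nat}.
Local Notation mu := (@lebesgue_rV R n).
Local Notation unif := (uniform_prob (@ltr01 R)).
Local Notation "'e_ i" := (delta_mx ord0 i : 'rV[R]_n) (at level 8, i at level 2).
Variables (p : R) (p1 : 1 < p).
Implicit Types (u v w : 'rV[R]_n -> R).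

Let p0 : 0 < p. Proof. by rewrite (lt_trans _ p1). Qed.

(** The multi-index [k e_i] is one of those over which the maximum is taken. *)
Lemma frac_le_sobolev s u i :
  (frac_seminorm (sobolev_frac s) p (weak_deriv (mindex1 i (sobolev_order s)) u)
   <= sobolev_seminorm s p u)%E.
Proof.
rewrite /sobolev_seminorm; set k := sobolev_order s.
pose a : {ffun 'I_n -> 'I_k.+1} := [ffun j => if j == i then ord_max else ord0].
have aE : (fun j => a j : nat) = mindex1 i k.
  by apply/funext => j; rewrite /a ffunE /mindex1; case: (j == i).
have ak : mdegree (fun j => a j : nat) == k by rewrite aE mdegree_mindex1.
rewrite -[X in weak_deriv X]aE.
exact: (@le_bigmax_cond _ _ _ _ a _
  (fun a : {ffun 'I_n -> 'I_k.+1} => frac_seminorm (sobolev_frac s) p (weak_deriv (fun j => a j : nat) u)) ak).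
Qed.

Lemma sobolev_weak_deriv s u i m : sobolev s p u -> (m <= sobolev_order s)%N ->
  is_weak_deriv (mindex1 i m) u (weak_deriv (mindex1 i m) u).
Proof.
move=> [[_ su] _] mk; apply: (xgetPex (cst 0)).
have [|v _ uv] := su (mindex1 i m); first by rewrite mdegree_mindex1.
by exists v.
Qed.

Lemma integral_unif_cst (c : R) :
  unif.-integrable setT (fun t : measurableTypeR R => c%:E) /\
  fine (\int[unif]_t c%:E)%E = c.
Proof.
have E : (\int[unif]_t c%:E = c%:E)%E.
  rewrite integral_cst//; have /= -> := @probability_setT _ _ _ unif.
  by rewrite mule1.
split; last by rewrite E.
apply/integrableP; split => //.
rewrite integral_cst//; have /= -> := @probability_setT _ _ _ unif.
by rewrite mule1 ltry.
Qed.

(** The weight [2 t h] of the second derivative in the symmetric first difference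
    has average [h].  The modulus makes the integrand nonnegative on the whole
    line, outside the support of the measure. *)
Lemma integral_unif_id (h : R) : 0 <= h ->
  unif.-integrable setT (fun t : measurableTypeR R => (2 * h * `|t|)%:E) /\
  fine (\int[unif]_t (2 * h * `|t|)%:E)%E = h.
Proof.
move=> h0.
have mf : measurable_fun [set: measurableTypeR R] (fun t => (2 * h * `|t|)%:E).
  by apply/measurable_EFinP/measurable_funM => //; exact: normr_measurable.
have E : (\int[unif]_t (2 * h * `|t|)%:E = h%:E)%E.
  rewrite integral_uniform//; last first.
    by move=> t; rewrite lee_fin !mulr_ge0.
  rewrite subr0 invr1 mul1e.
  transitivity (\int[lebesgue_measure]_(t in `[0%R, 1%R]) (2 * h * t)%:E)%E.
    apply: eq_integral => t; rewrite inE/= in_itv/= => /andP[t0 _].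
    by rewrite ger0_norm.
  have dF (t : R) : is_derive t 1 (fun t => h *: t ^+ 2) (2 * h * t).
    by apply: is_derive_eq; rewrite /GRing.scale/= mulr1; ring.
  have cF : continuous (fun t : R => h *: t ^+ 2).
    move=> t; apply: differentiable_continuous; apply/derivable1_diffP.
    by have [] := dF t.
  rewrite (@continuous_FTC2 _ _ (fun t => h *: t ^+ 2))//=.
  - by rewrite /GRing.scale/= expr1n expr0n/= mulr1 mulr0 sube0.
  - by apply: continuous_subspaceT => t; apply: mulrl_continuous.
  - split.
    + by move=> x _; have [] := dF x.
    + exact/cvg_at_right_filter/cF.
    + exact/cvg_at_left_filter/cF.
  - by move=> x _; rewrite derive1E; have [_] := dF x.
split; last by rewrite E.
apply/integrableP; split => //.
under eq_integral do rewrite gee0_abs ?lee_fin ?mulr_ge0//.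
by rewrite E ltry.
Qed.

Lemma pint_div_le (f : 'rV[R]_n -> R) (c : R) B : c != 0 -> measurable_fun setT f ->
  (pint p f <= (`|c| `^ p)%:E * B)%E -> (pint p (fun x => c^-1 * f x)%R <= B)%E.
Proof.
move=> c0 mf H; rewrite pintZ//.
have cp : 0 < `|c| `^ p by rewrite powR_gt0// normr_gt0.
have -> : `|c^-1| `^ p = (`|c| `^ p)^-1.
  by rewrite normfV -powR_inv1// powRAC powR_inv1// powR_ge0.
by rewrite lee_pdivrMl.
Qed.

(** Taking [p]-th roots at the end of the argument. *)
Lemma Lnorm_le_root (f : 'rV[R]_n -> R) (C a h : R) X : 0 < C -> 0 < h -> (0 <= X)%E ->
  (pint p f <= (C * h `^ (a * p))%:E * X `^ p)%E ->
  (Lnorm mu p%:E (EFin \o f) <= (C `^ p^-1)%:E * X * (h `^ a)%:E)%E.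
Proof.
move=> C0 h0 X0 H; rewrite Lnorm_pint.
have -> : ((C `^ p^-1)%:E * X * (h `^ a)%:E =
    ((C * h `^ (a * p))%:E * X `^ p) `^ p^-1)%E.
  rewrite poweRM ?poweR_ge0 ?lee_fin ?mulr_ge0 ?powR_ge0 ?(ltW C0)//.
  rewrite -poweRrM mulfV ?lt0r_neq0// poweRe1// poweR_EFin powRM ?powR_ge0 ?(ltW C0)//.
  by rewrite -powRrM -mulrA mulfV ?lt0r_neq0// mulr1 EFinM muleAC.
apply: gt0_ler_poweR => //; rewrite ?in_itv/= ?leey ?andbT.
- by rewrite invr_ge0 ltW.
- exact: pint_ge0.
- by rewrite mule_ge0// ?poweR_ge0// lee_fin mulr_ge0 ?powR_ge0 ?(ltW C0).
Qed.

Lemma measurable_shift v (y : 'rV[R]_n) : measurable_fun setT v ->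
  measurable_fun setT (fun x : 'rV[R]_n => v (x + y)).
Proof. by move=> mv; apply: (measurableT_comp mv); exact: measurable_rV_add. Qed.

Lemma pint_pair_le v i (b sgn : R) B : measurable_fun setT v -> `|sgn| = 1 ->
  (increment p v (b *: 'e_ i) <= B)%E -> (increment p v (- b *: 'e_ i) <= B)%E ->
  (pint p (fun x => (v (x + b *: 'e_ i) - v x) + sgn * (v (x + - b *: 'e_ i) - v x))%R
   <= (2 `^ p * 2)%:E * B)%E.
Proof.
move=> mv sgn1 H1 H2.
have m1 : measurable_fun setT (fun x : 'rV[R]_n => v (x + b *: 'e_ i) - v x).
  by apply: measurable_funB => //; exact: measurable_shift.
have m2 : measurable_fun setT (fun x : 'rV[R]_n => v (x + - b *: 'e_ i) - v x).
  by apply: measurable_funB => //; exact: measurable_shift.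
apply: (le_trans (pintD p1 m1 (measurable_funM (measurable_cst sgn) m2))).
rewrite EFinM -muleA lee_wpmul2l ?lee_fin ?powR_ge0//.
rewrite pintZ// sgn1 powR1 mul1e.
have -> : (2%:E * B = B + B)%E by rewrite mule_natl mule2n.
exact: (leeD H1 H2).
Qed.
Lemma first_difference_le u v i (h : R) B : tensor_weak_deriv i u v -> 0 < h ->
  (forall t, 0 <= t <= h -> (increment p v (t *: 'e_ i) <= B)%E) ->
  (pint p (fun x => (u (x + h *: 'e_ i) - u x) / h - v x)%R <= B)%E.
Proof.
move=> uv h0 HB; have [[mu_ _] [mv _] _] := uv.
pose f x := (u (x + h *: 'e_ i) - u x) + 0 * (u (x + - h *: 'e_ i) - u x) - h * (1 * v x).
have mf : measurable_fun setT f.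
  apply: measurable_funB; last by apply: measurable_funM => //; exact: measurable_funM.
  apply: measurable_funD; first by apply: measurable_funB => //; exact: measurable_shift.
  by apply: measurable_funM => //; apply: measurable_funB => //; exact: measurable_shift.
rewrite (_ : (fun x => _) = (fun x => h^-1 * f x)); last first.
  by apply/funext => x; rewrite /f; field; rewrite gt_eqF.
apply: pint_div_le => //; first by rewrite gt_eqF.
have [i1 E1] := @integral_unif_cst 1.
apply: (@pint_increment_le _ _ _ p1 i u v h 0 1 v (fun=> 1)) => // t /andP[t0 t1].
rewrite (_ : (fun x => _) = (fun x => v (x + (t * h) *: 'e_ i) - v x)); last first.
  by apply/funext => x; rewrite mul0r subr0 mul1r scalerA.
by apply: HB; rewrite mulr_ge0 ?(ltW h0)//= ler_piMl// ltW.
Qed.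

Lemma central_difference_le v w i (b : R) B : tensor_weak_deriv i v w -> 0 <= b ->
  (forall t, 0 <= t <= b ->
    (pint p (fun x => w (x + t *: 'e_ i) - w (x + - t *: 'e_ i))%R <= B)%E) ->
  (pint p (fun x => (v (x + b *: 'e_ i) - v x) + 1 * (v (x + - b *: 'e_ i) - v x))%R
    <= (b `^ p)%:E * B)%E.
Proof.
move=> vw b0 HB.
have [i0 E0] := @integral_unif_cst 0.
have := @pint_increment_le _ _ _ p1 i v w b 1 0
  (cst 0) (fun=> 0) B vw (measurable_cst _) (measurable_cst _) i0 E0.
rewrite (ger0_norm b0) (_ : (fun x => v (x + b *: 'e_ i) - v x
    + 1 * (v (x + - b *: 'e_ i) - v x) - b * (0 * cst 0 x)) =
  (fun x => v (x + b *: 'e_ i) - v x + 1 * (v (x + - b *: 'e_ i) - v x))); last first.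
  by apply/funext => x; rewrite mul0r mulr0 subr0.
apply => t /andP[t0 t1].
rewrite (_ : (fun x => _) = (fun x => w (x + (t * b) *: 'e_ i) - w (x + - (t * b) *: 'e_ i))).
  by apply: HB; rewrite mulr_ge0//= ler_piMl.
by apply/funext => x; rewrite mul1r mul0r subr0 !scalerA mulrN.
Qed.

(** With [eps = 1] and the correction [2 t h * w x] the second difference of [u] is
    [h] times an average of [v (x + a e_i) - v (x - a e_i) - 2 a w x], [a = t h];
    with [eps = -1] this is in turn [a] times an average of central second
    differences of [w]. *)
Lemma second_difference_le u v w i (h : R) B :
  tensor_weak_deriv i u v -> tensor_weak_deriv i v w -> 0 < h -> (0 <= B)%E ->
  (forall b, 0 <= b <= h ->
    (pint p (fun x => (w (x + b *: 'e_ i) - w x) + 1 * (w (x + - b *: 'e_ i) - w x))%R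
     <= B)%E) ->
  (pint p (fun x => (u (x + h *: 'e_ i) + u (x - h *: 'e_ i) - 2 * u x) / h ^+ 2 - w x)%R
    <= B)%E.
Proof.
move=> uv vw h0 B0 HB; have [[mu_ _] [mv _] _] := uv; have [_ [mw _] _] := vw.
pose f x := (u (x + h *: 'e_ i) - u x) + 1 * (u (x + - h *: 'e_ i) - u x) - h * (h * w x).
have mf : measurable_fun setT f.
  apply: measurable_funB; last by apply: measurable_funM => //; exact: measurable_funM.
  apply: measurable_funD; first by apply: measurable_funB => //; exact: measurable_shift.
  by apply: measurable_funM => //; apply: measurable_funB => //; exact: measurable_shift.
rewrite (_ : (fun x => _) = (fun x => h^-1 * (h^-1 * f x))); last first.
  by apply/funext => x; rewrite /f scaleNr; field; rewrite gt_eqF.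
have hn0 : h != 0 by rewrite gt_eqF.
apply: pint_div_le => //; first exact: measurable_funM.
apply: pint_div_le => //.
have [ih Eh] := integral_unif_id (ltW h0).
have mk : measurable_fun [set: measurableTypeR R] (fun t => 2 * h * `|t|).
  by apply: measurable_funM => //; exact: normr_measurable.
apply: (@pint_increment_le _ _ _ p1 i u v h 1 h
  w (fun t => 2 * h * `|t|)) => // t /andP[t0 t1].
rewrite (ger0_norm (ltW h0)).
have [i2 E2] := @integral_unif_cst 2.
pose a := t * h.
have a0 : 0 <= a by rewrite mulr_ge0// ltW.
have ah : a <= h by rewrite ler_piMl// ltW.
apply: (@le_trans _ _ ((`|a| `^ p)%:E * B)%E); last first.
  apply: lee_wpmul2r => //; rewrite lee_fin (ger0_norm a0).
  by apply: ge0_ler_powR; rewrite ?nnegrE// ?(ltW h0)// ltW.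
have := @pint_increment_le _ _ _ p1 i v w a (-1) 2 w (fun=> 2)
  B vw mw (measurable_cst _) i2 E2.
rewrite (_ : (fun x => v (x + a *: 'e_ i) - v x +
      -1 * (v (x + - a *: 'e_ i) - v x) - a * (2 * w x)) =
  (fun x => v (x + t *: (h *: 'e_ i)) - 1 * v (x + t *: (- h *: 'e_ i)) -
      2 * h * `|t| * w x)); last first.
  by apply/funext => x; rewrite !scalerA mulrN (ger0_norm t0) -/a /a; ring.
apply => q /andP[q0 q1].
rewrite (_ : (fun x => _) =
  (fun x => (w (x + (q * a) *: 'e_ i) - w x) + 1 * (w (x + - (q * a) *: 'e_ i) - w x))).
  apply: HB; rewrite mulr_ge0//=; apply: le_trans ah.
  by rewrite ler_piMl.
by apply/funext => x; rewrite !scalerA mulrN; ring.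
Qed.

Lemma sobolev_seminorm_ge0 s u : (0 <= sobolev_seminorm s p u)%E.
Proof. by rewrite /sobolev_seminorm; apply: bigmax_ge_id. Qed.

Lemma tensor_weak_deriv_succ s u v i m : sobolev s p u -> (m < sobolev_order s)%N ->
  is_weak_deriv (mindex1 i m) u v ->
  tensor_weak_deriv i v (weak_deriv (mindex1 i m.+1) u).
Proof.
by move=> su mk uv; exact: weak_deriv_tensor uv (sobolev_weak_deriv i su mk).
Qed.

Lemma sobolev_order_frac k (s : R) : k%:R < s <= k.+1%:R ->
  sobolev_order s = k /\ sobolev_frac s = s - k%:R.
Proof.
move=> /andP[ks sk].
have E : sobolev_order s = k.
  rewrite -(subrK k%:R s) addrC sobolev_orderE// subr_gt0 ks/=.
  by rewrite lerBlDl -natr1 in sk *.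
by rewrite /sobolev_frac E.
Qed.

(** The Nikolskii estimate for the derivative of top integer order. *)
Lemma increment_sobolev_le k (s : R) : (0 < n)%N -> k%:R < s <= k.+1%:R ->
  exists2 C : R, 0 < C & forall u, sobolev s p u ->
    forall i (t h : R), 0 < h -> `|t| <= h ->
    (increment p (weak_deriv (mindex1 i k) u) (t *: 'e_ i) <=
      (C * h `^ ((s - k%:R) * p))%:E * sobolev_seminorm s p u `^ p)%E.
Proof.
move=> n0 ks; have [kE fE] := sobolev_order_frac ks; move/andP: ks => [ks sk].
have [|C C0 HC] := @increment_frac_le R n p p1 (s - k%:R) _ n0.
  by rewrite subr_gt0 ks/= lerBlDl natr1.
exists C => // u su i t h h0 th.
have [_ [mv _] _] : is_weak_deriv (mindex1 i k) u (weak_deriv (mindex1 i k) u).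
  by apply: (sobolev_weak_deriv i su); rewrite kE.
apply: (le_trans (HC _ mv i t h h0 th)); apply: lee_wpmul2l.
  by rewrite lee_fin mulr_ge0 ?powR_ge0// ltW.
have := frac_le_sobolev s u i; rewrite kE fE => F.
have F0 : (0 <= frac_seminorm (s - k%:R) p (weak_deriv (mindex1 i k) u))%E.
  rewrite /frac_seminorm; case: ifP => _; last exact: poweR_ge0.
  by rewrite /gradient_seminorm; case: ifP => // _; exact: Lnorm_ge0.
by apply: gt0_ler_poweR => //; rewrite ?in_itv/= ?leey ?andbT ?(ltW p0)// sobolev_seminorm_ge0.
Qed.

Lemma first_difference_sobolev s : (0 < n)%N -> 1 < s <= 2 ->
  exists2 C : R, 0 < C & forall u, sobolev s p u -> forall i (h : R), 0 < h ->
    (pint p (fun x => (u (x + h *: 'e_ i) - u x) / h - weak_deriv (mindex1 i 1) u x)%R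
      <= (C * h `^ ((s - 1) * p))%:E * sobolev_seminorm s p u `^ p)%E.
Proof.
move=> n0 s12; have [kE _] := @sobolev_order_frac 1 s s12.
have [C C0 HC] := @increment_sobolev_le 1 s n0 s12; exists C => // u su i h h0.
have [lu _ _] : is_weak_deriv (mindex1 i 1) u (weak_deriv (mindex1 i 1) u).
  by apply: (sobolev_weak_deriv i su); rewrite kE.
have uv : tensor_weak_deriv i u (weak_deriv (mindex1 i 1) u).
  by apply: (tensor_weak_deriv_succ su _ (is_weak_deriv0 i lu)); rewrite kE.
apply: (first_difference_le uv h0) => t /andP[t0 th].
by apply: HC => //; rewrite ger0_norm.
Qed.

(** The second difference is controlled by the central second differences of
    the weak derivative of order 2 at the scales between 0 and [h].  When
    [s <= 3] these are sums of two increments, and the Nikolskii estimate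
    applies to them directly.  When [s > 3] one writes them once more as averages
    of symmetric first differences of the third derivative, which gains the
    missing factor [h]. *)
Lemma second_difference_sobolev s : (0 < n)%N -> 2 < s <= 4 ->
  exists2 C : R, 0 < C & forall u, sobolev s p u -> forall i (h : R), 0 < h ->
    (pint p (fun x => (u (x + h *: 'e_ i) + u (x - h *: 'e_ i) - 2 * u x) / h ^+ 2
        - weak_deriv (mindex1 i 2) u x)%R
      <= (C * h `^ ((s - 2) * p))%:E * sobolev_seminorm s p u `^ p)%E.
Proof.
move=> n0 /andP[s2 s4].
(* the integer order is 2 or 3 *)
have [k k2 ks] : exists2 k, (k == 2%N) || (k == 3%N) & k%:R < s <= k.+1%:R.
  by have [s3|s3] := leP s 3; [exists 2%N|exists 3%N] => //; rewrite ?s2 ?s3.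
have [kE _] := sobolev_order_frac ks.
have [C C0 HC] := increment_sobolev_le n0 ks.
exists (2 `^ p * 2 * C); first by rewrite !mulr_gt0// powR_gt0.
move=> u su i h h0.
have dm m : (m <= k)%N -> is_weak_deriv (mindex1 i m) u (weak_deriv (mindex1 i m) u).
  by move=> mk; apply: (sobolev_weak_deriv i su); rewrite kE.
have k1 : (1 < k)%N by case/orP: k2 => /eqP ->.
have [lu _ _] := dm 1%N (ltnW k1).
have uv : tensor_weak_deriv i u (weak_deriv (mindex1 i 1) u).
  by apply: (tensor_weak_deriv_succ su _ (is_weak_deriv0 i lu)); rewrite kE ltnW.
have vw : tensor_weak_deriv i (weak_deriv (mindex1 i 1) u) (weak_deriv (mindex1 i 2) u).
  by apply: (tensor_weak_deriv_succ su _ (dm _ (ltnW k1))); rewrite kE.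
have [_ [mk _] _] := dm k (leqnn k).
pose X := (sobolev_seminorm s p u `^ p)%E; have X0 : (0 <= X)%E by exact: poweR_ge0.
pose B := ((C * h `^ ((s - k%:R) * p))%:E * X)%E.
have pairB (sgn b : R) : `|sgn| = 1 -> 0 <= b <= h ->
    (pint p (fun x => (weak_deriv (mindex1 i k) u (x + b *: 'e_ i)
         - weak_deriv (mindex1 i k) u x)
       + sgn * (weak_deriv (mindex1 i k) u (x + - b *: 'e_ i)
         - weak_deriv (mindex1 i k) u x))%R <= (2 `^ p * 2)%:E * B)%E.
  move=> sgn1 /andP[b0 bh].
  by apply: pint_pair_le => //; apply: HC => //; rewrite ?normrN ger0_norm.
apply: (second_difference_le uv vw h0) => [|b /andP[b0 bh]].
  by rewrite mule_ge0// lee_fin !mulr_ge0 ?powR_ge0// ltW.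
case/orP: k2 => /eqP kk; rewrite kk in kE; subst k.
  rewrite -(mulrA (2 `^ p * 2)) EFinM -muleA.
  by apply: pairB; rewrite ?normr1// b0.
have wz : tensor_weak_deriv i (weak_deriv (mindex1 i 2) u) (weak_deriv (mindex1 i 3) u).
  by apply: (tensor_weak_deriv_succ su _ (dm _ k1)); rewrite kE.
apply: (le_trans (central_difference_le wz b0 (B := ((2 `^ p * 2)%:E * B)%E) _)).
  move=> t /andP[t0 tb]; have th : t <= h by exact: le_trans tb bh.
  rewrite (_ : (fun x => _) = (fun x =>
    (weak_deriv (mindex1 i 3) u (x + t *: 'e_ i) - weak_deriv (mindex1 i 3) u x)
    + -1 * (weak_deriv (mindex1 i 3) u (x + - t *: 'e_ i)
            - weak_deriv (mindex1 i 3) u x))); last first.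
    by apply/funext => x; ring.
  by apply: pairB; rewrite ?normrN1// t0.
rewrite !muleA -!EFinM; apply: lee_wpmul2r => //.
rewrite lee_fin.
have -> : h `^ ((s - 2) * p) = h `^ p * h `^ ((s - 3) * p).
  rewrite -powRD; last by rewrite (gt_eqF h0) implybT.
  by congr (_ `^ _); ring.
have -> : 2 `^ p * 2 * C * (h `^ p * h `^ ((s - 3) * p)) =
  h `^ p * (2 `^ p * 2) * (C * h `^ ((s - 3) * p)) by ring.
rewrite -!mulrA; apply: ler_wpM2r.
  by rewrite !mulr_ge0 ?powR_ge0// ltW.
by apply: ge0_ler_powR; rewrite ?nnegrE ?(ltW p0) ?(ltW h0).
Qed.

End difference_quotients.

Theorem theorem2p4 (R : realType) (n : nat) (p : R) (hn : (1 <= n)%N)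
    (hp : 1 < p) :
  (forall s : R, 1 < s <= 2 ->
     exists2 c : R, 0 < c &
       forall (u : 'rV[R]_n -> R), sobolev s p u ->
       forall (i : 'I_n) (h : R), 0 < h ->
         (Lnorm (lebesgue_rV n) p%:E (fun x : 'rV[R]_n =>
            ((u (x + h *: delta_mx ord0 i) - u x) / h
             - weak_deriv (mindex1 i 1) u x)%:E)
          <= c%:E * sobolev_seminorm s p u * (h `^ (s - 1))%:E)%E) /\
  (forall s : R, 2 < s <= 4 ->
     exists2 c : R, 0 < c &
       forall (u : 'rV[R]_n -> R), sobolev s p u ->
       forall (i : 'I_n) (h : R), 0 < h ->
         (Lnorm (lebesgue_rV n) p%:E (fun x : 'rV[R]_n =>
            ((u (x + h *: delta_mx ord0 i) + u (x - h *: delta_mx ord0 i)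
              - 2 * u x) / h ^+ 2
             - weak_deriv (mindex1 i 2) u x)%:E)
          <= c%:E * sobolev_seminorm s p u * (h `^ (s - 2))%:E)%E).
Proof.
have n0 : (0 < n)%N by [].
split=> s s12.
  have [C C0 HC] := first_difference_sobolev hp n0 s12.
  exists (C `^ p^-1); first by rewrite powR_gt0.
  move=> u su i h h0.
  apply: (Lnorm_le_root (f := fun x => (u (x + h *: delta_mx ord0 i) - u x) / h
             - weak_deriv (mindex1 i 1) u x) hp C0 h0).
    exact: sobolev_seminorm_ge0.
  exact: HC.
have [C C0 HC] := second_difference_sobolev hp n0 s12.
exists (C `^ p^-1); first by rewrite powR_gt0.
move=> u su i h h0.
apply: (Lnorm_le_root (f := fun x => (u (x + h *: delta_mx ord0 i)
   + u (x - h *: delta_mx ord0 i) - 2 * u x) / h ^+ 2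
           - weak_deriv (mindex1 i 2) u x) hp C0 h0).
  exact: sobolev_seminorm_ge0.
exact: HC.
Qed.
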